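(* Let $k$ be an algebraically closed field and let $G$ be an affine group scheme over $k$, written as an inverse limit $G = \varprojlim_{i \in I} G_i$ over a directed poset $I$ of affine group schemes $G_i$ of finite type over $k$. Assume that one of the following conditions holds: i) the poset $I$ is (at most) countable; ii) the cardinality of $I$ is strictly less than the cardinality of $k$. Then every $G$-torsor $P$ over $k$ is trivial, i.e. $P(k) \neq \emptyset$.
   Context: A directed poset is a non-empty partially ordered set in which any two elements have a common upper bound. The inverse limit $G = \varprojlim_{i\in I} G_i$ is taken in the category of affine group schemes over $k$, over an inverse system indexed by $I$ whose transition maps are homomorphisms of group schemes over $k$; the $G_i$ are not assumed to be reduced. (Any affine group scheme over a field can be written as such a limit.) A $G$-torsor $P$ over $k$ is a non-empty affine scheme $P$ over $k$ with an action of $G$ (over $k$) such that the morphism $G \times_k P \to P \times_k P$, $(g,p) \mapsto (gp,p)$, is an isomorphism. $P$ is not assumed to be of finite type over $k$. *)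

(* Defs.v *)
From HB Require Import structures.
From mathcomp Require Import all_boot all_order all_algebra.
From mathcomp Require Import classical_sets cardinality.
From mathcomp Require Import mpoly.

Set Implicit Arguments.
Unset Strict Implicit.
Unset Printing Implicit Defensive.

Import Order.TTheory GRing.Theory.
Local Open Scope ring_scope.

(* An affine k-scheme X = Spec A is represented by its coordinate algebra A and
   handled through its functor of points X(R) = Hom_{k-alg}(A, R).  By Yoneda,
   a morphism X -> Y is a family X(R) -> Y(R) natural in R, equivalently a
   k-algebra morphism k[Y] -> k[X], and it is an isomorphism iff it is
   bijective on R-points for every R; the product X x_k Y has R-points
   X(R) * Y(R).
   A comAlgType is a non-zero ring, so the schemes considered are the non-empty
   affine ones.  This loses nothing: a group scheme has a unit section, torsors
   are required to be non-empty, and the zero algebra as test ring R carries no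
   information (every affine scheme has exactly one point with values in it). *)
Definition points (k : fieldType) (A R : comAlgType k) : Type :=
  {lrmorphism A -> R}.

(* X(phi) : X(R) -> X(S) for phi : R -> S *)
Definition points_map (k : fieldType) (A R S : comAlgType k)
    (phi : {lrmorphism R -> S}) (x : points A R) : points A S :=
  phi \o x.

(* Y(R) <- X(R) induced by a morphism X -> Y with comorphism f : k[Y] -> k[X] *)
Definition points_comap (k : fieldType) (B A R : comAlgType k)
    (f : {lrmorphism B -> A}) (x : points A R) : points B R :=
  x \o f.

(* Group structures on the sets G(R), functorial in R. *)
Record affine_group_scheme (k : fieldType) := AffineGroupScheme {
  group_coord : comAlgType k;
  gmul : forall R : comAlgType k,
    points group_coord R -> points group_coord R -> points group_coord R;
  gone : forall R : comAlgType k, points group_coord R;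
  ginv : forall R : comAlgType k, points group_coord R -> points group_coord R;
  gmul_natural : forall (R S : comAlgType k) (phi : {lrmorphism R -> S})
      (x y : points group_coord R),
    points_map phi (gmul x y) = gmul (points_map phi x) (points_map phi y);
  gone_natural : forall (R S : comAlgType k) (phi : {lrmorphism R -> S}),
    points_map phi (gone R) = gone S;
  ginv_natural : forall (R S : comAlgType k) (phi : {lrmorphism R -> S})
      (x : points group_coord R),
    points_map phi (ginv x) = ginv (points_map phi x);
  gmulA : forall R : comAlgType k, associative (@gmul R);
  gmul1g : forall R : comAlgType k, left_id (gone R) (@gmul R);
  gmulVg : forall R : comAlgType k, left_inverse (gone R) (@ginv R) (@gmul R)
}.

(* Homomorphisms G -> H, given by their comorphism k[H] -> k[G]. *)
Record group_scheme_hom (k : fieldType) (G H : affine_group_scheme k) :=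
    GroupSchemeHom {
  comorph : {lrmorphism group_coord H -> group_coord G};
  comorph_mul : forall (R : comAlgType k) (x y : points (group_coord G) R),
    points_comap comorph (gmul x y) =
    gmul (points_comap comorph x) (points_comap comorph y)
}.

(* k[G] is a quotient of a polynomial algebra in finitely many variables. *)
Definition of_finite_type (k : fieldType) (G : affine_group_scheme k) : Prop :=
  exists (n : nat) (f : {lrmorphism {mpoly k[n]} -> group_coord G}),
    forall a : group_coord G, exists p : {mpoly k[n]}, f p = a.

Definition directed_poset (d : Order.disp_t) (I : porderType d) : Prop :=
  inhabited I /\ forall i j : I, exists l : I, (i <= l)%O /\ (j <= l)%O.

Record inverse_system (k : fieldType) (d : Order.disp_t) (I : porderType d) :=
    InverseSystem {
  component : I -> affine_group_scheme k;
  transition : forall i j : I, (i <= j)%O ->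
    group_scheme_hom (component j) (component i);
  transition_id : forall (i : I) (le_ii : (i <= i)%O),
    comorph (transition le_ii) =1 id;
  transition_comp : forall (i j l : I)
      (le_ij : (i <= j)%O) (le_jl : (j <= l)%O) (le_il : (i <= l)%O),
    comorph (transition le_il) =1
    comorph (transition le_jl) \o comorph (transition le_ij)
}.

Definition compatible_cone (k : fieldType) (d : Order.disp_t)
    (I : porderType d) (S : inverse_system k I) (H : affine_group_scheme k)
    (q : forall i : I, group_scheme_hom H (component S i)) : Prop :=
  forall (i j : I) (le_ij : (i <= j)%O),
    comorph (q i) =1 comorph (q j) \o comorph (transition S le_ij).

(* Universal property in the category of affine group schemes over k. *)
Definition is_inverse_limit (k : fieldType) (d : Order.disp_t)
    (I : porderType d) (S : inverse_system k I) (G : affine_group_scheme k)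
    (pr : forall i : I, group_scheme_hom G (component S i)) : Prop :=
  compatible_cone pr /\
  forall (H : affine_group_scheme k)
      (q : forall i : I, group_scheme_hom H (component S i)),
    compatible_cone q ->
    exists u : group_scheme_hom H G,
      (forall i : I, comorph (q i) =1 comorph u \o comorph (pr i)) /\
      forall v : group_scheme_hom H G,
        (forall i : I, comorph (q i) =1 comorph v \o comorph (pr i)) ->
        comorph v =1 comorph u.

(* The last field says that G x P -> P x P, (g, p) |-> (g p, p), is an
   isomorphism.  No finiteness condition is imposed on torsor_coord. *)
Record torsor (k : fieldType) (G : affine_group_scheme k) := Torsor {
  torsor_coord : comAlgType k;
  tact : forall R : comAlgType k,
    points (group_coord G) R -> points torsor_coord R -> points torsor_coord R;
  tact_natural : forall (R S : comAlgType k) (phi : {lrmorphism R -> S})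
      (g : points (group_coord G) R) (p : points torsor_coord R),
    points_map phi (tact g p) = tact (points_map phi g) (points_map phi p);
  tact1 : forall (R : comAlgType k) (p : points torsor_coord R),
    tact (gone G R) p = p;
  tactM : forall (R : comAlgType k) (g h : points (group_coord G) R)
      (p : points torsor_coord R),
    tact (gmul g h) p = tact g (tact h p);
  tact_shear : forall R : comAlgType k,
    bijective (fun gp : points (group_coord G) R * points torsor_coord R =>
                 (tact gp.1 gp.2, gp.2))
}.

(* P(k) <> set0; the algebra k over itself is the regular algebra k^o. *)
Definition trivial_torsor (k : fieldType) (G : affine_group_scheme k)
    (P : torsor G) : Prop :=
  inhabited (points (torsor_coord P) k^o).

Definition card_lt (T U : Type) : Prop :=
  ([set: T] #<= [set: U])%card /\ ~ ([set: U] #<= [set: T])%card.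

(* Main.v *)
Require Import Defs.
From HB Require Import structures.
From mathcomp Require Import all_boot all_order all_algebra.
From mathcomp Require Import generic_quotient ring_quotient fraction.
From mathcomp Require Import boolp classical_sets functions cardinality.
From mathcomp Require mpoly.

(* Write A = k[G] and B = k[P].  The torsor structure gives a coaction
   rho : B -> A (x) B and a division map delta : A -> B (x) B with
   "delta(p, q) q = p".

   A is the directed union of the images A_i of the k[G_i], hence B is the union
   of finitely generated subalgebras indexed by I, namely those generated by the
   left tensor factors of delta(A_i).

   If I is uncountable and smaller than k, let m be a maximal ideal of B.  If
   some t in K = B/m is not a scalar, then each 1 / (t - c), c in k, lies in the
   image of one of these subalgebras, and each of them contains only finitely
   many 1 / (t - c).  So k embeds into I x N, hence into I, a contradiction;
   therefore B/m = k.

   If I is countable, B is the union of an increasing sequence of finitely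
   generated subalgebras C_n, and it suffices that for each n the images of
   C_m(k) in C_n(k), m >= n, become stationary.  Let p in C_m(k), m large, and
   q in C_m''(k), m'' larger still.  Then g = delta(p, q) is a point of some A_j;
   lift it to a point g' of a larger A_j'.  Then g'q has the same image in C_n(k)
   as p, and is defined on a subalgebra that can be made as large as one wants.

   Points of A_j lift to A_j': any dominant morphism of finite type hits, in each
   irreducible component, all points of a nonempty open subset, and every
   g in A_j(k) is a product (g x^-1) x where x, g x^-1 both lie in such subsets. *)

Set Implicit Arguments.
Unset Strict Implicit.
Unset Printing Implicit Defensive.

Import GRing.Theory.
Local Open Scope ring_scope.

(** * Zorn arguments *)

Section Zorn.
Local Open Scope classical_set_scope.
Local Open Scope card_scope.

(** Zorn's lemma is applied to the sets [X] whose union with [A0] satisfies [P]. The empty chain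
    then yields [A0] itself, so [P] has to be checked on non-empty chains only. *)
Lemma Zorn_above (T : Type) (P : set (set T)) (A0 : set T) :
  P A0 ->
  (forall F : set (set T), F `<=` P -> total_on F subset -> F !=set0 ->
     P (\bigcup_(X in F) X)) ->
  exists A, [/\ P A, A0 `<=` A & forall B, P B -> A `<=` B -> B `<=` A].
Proof.
move=> PA0 chainP.
have [|A [PA Amax]] := @Zorn_bigcup T [set X | P (X `|` A0)].
  move=> F FP Ftot /=; have [->|F0] := eqVneq F set0.
    by rewrite bigcup_set0 set0U.
  have/set0P[Y FY] := F0.
  have -> : \bigcup_(X in F) X `|` A0
            = \bigcup_(Z in [set X `|` A0 | X in F]) Z.
    rewrite seteqP; split=> x.
      case=> [[X FX Xx]|A0x].
        by exists (X `|` A0); [exists X|left].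
      by exists (Y `|` A0); [exists Y|right].
    by case=> _ [X FX <-] [Xx|A0x]; [left; exists X|right].
  apply: chainP; last by exists (Y `|` A0), Y.
    by move=> _ [X FX <-]; apply: FP.
  move=> _ _ [X FX <-] [Z FZ <-].
  by case: (Ftot _ _ FX FZ) => h; [left|right]; apply: setSU.
exists (A `|` A0); split=> // B PB AB x Bx; apply: contrapT => nx.
apply: (Amax B); last first.
  by rewrite /= (_ : B `|` A0 = B) //; apply/setUidl => y A0y; apply: AB; right.
by split=> [y Ay|/(_ x Bx) Ax]; [apply: AB; left|apply: nx; left].
Qed.

Lemma total_on_pair (T : Type) (F : set (set T)) x y :
  total_on F subset -> (\bigcup_(X in F) X) x -> (\bigcup_(X in F) X) y ->
  exists X, [/\ F X, X x & X y].
Proof.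
move=> Ftot [X FX Xx] [Y FY Yy].
by case: (Ftot _ _ FX FY) => h; [exists Y|exists X]; split=> //; apply: h.
Qed.

(* A maximal family of disjoint sequences covers all but finitely many elements
   of X; the leftover times nat is stored along the odd terms of one sequence. *)
Lemma infinite_prod_nat_injection (X : Type) :
  infinite_set [set: X] -> exists f : X * nat -> X, injective f.
Proof.
move=> Xinf; pose Q (F : set (nat -> X)) := forall f g m n,
  F f -> F g -> f m = g n -> f = g /\ m = n.
have [|F0 FQ Ftot _ f g m n Ff Fg|F [FQ _ Fmax]] := @Zorn_above _ Q set0.
- by [].
- have [h [Fh hf hg]] := total_on_pair Ftot Ff Fg.
  exact: (FQ h Fh).
pose R x := forall f n, F f -> f n <> x.
have Rfin : finite_set R.
  apply: contrapT => /infiniteP/card_leP[s0]; pose s n := set_val (s0 (to_setT n)).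
  have s_inj : injective s.
    by move=> m n /val_inj/(inj (mem_setT _) (mem_setT _))/(congr1 val).
  have Rs n : R (s n) by apply: set_mem; apply: valP.
  have sF : F s.
    (* An injective sequence in the uncovered part [R] is disjoint from the family, so by maximality
       it already belongs to it and its terms are covered. *)
    apply: (Fmax (F `|` [set (s : nat -> X)])); last by right.
      move=> f g m n [Ff|->] [Fg|->] E; first exact: FQ E.
      - by case: (Rs n f m Ff).
      - by case: (Rs m g n Fg).
      - by split=> //; apply: s_inj.
    by move=> f; left.
  exact: (Rs 0%N s 0%N sF).
have [f0 Ff0] : exists f, F f.
  apply: contrapT => noF; apply: Xinf; apply: sub_finite_set Rfin => x _ f n Ff.
  by case: noF; exists f.
have [c c_inj] : exists c : X -> nat, forall x y, R x -> R y -> c x = c y -> x = y.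
  have /countable_injP[c c_inj] := finite_set_countable Rfin.
  by exists c => x y Rx Ry; apply: c_inj; rewrite inE.
have /choice[r rP] : forall x, exists fn : (nat -> X) * nat,
    ~ R x -> F fn.1 /\ fn.1 fn.2 = x.
  move=> x; have [[f [n [Ff fn]]]|no] := pselect (exists f n, F f /\ f n = x).
    by exists (f, n).
  by exists (f0, 0%N) => nR; case: nR => f n Ff fn; case: no; exists f, n.
(* Even places serve the covered elements: the [n]-th term of a sequence, paired with [m], goes to
   the term [e n m] of the same sequence. *)
pose e (n m : nat) := (pickle (n, m)).*2.
have e_inj n m n' m' : e n m = e n' m' -> n = n' /\ m = m'.
  by move=> /double_inj/(pcan_inj pickleK)[-> ->].
exists (fun xm => if pselect (R xm.1) then f0 (e (c xm.1) xm.2).+1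
  else (r xm.1).1 (e (r xm.1).2 xm.2)).
move=> [x m] [y n] /=; case: pselect => Rx; case: pselect => Ry.
- by case/(FQ _ _ _ _ Ff0 Ff0) => _ [] /e_inj[/(c_inj _ _ Rx Ry)-> ->].
- have [Fr _] := rP y Ry; case/(FQ _ _ _ _ Ff0 Fr) => _ /(congr1 odd).
  by rewrite /= !odd_double.
- have [Fr _] := rP x Rx; case/(FQ _ _ _ _ Fr Ff0) => _ /(congr1 odd).
  by rewrite /= !odd_double.
- have [Fx rx] := rP x Rx; have [Fy ry] := rP y Ry.
  case/(FQ _ _ _ _ Fx Fy) => rr /e_inj[r2 ->]; congr (_, _).
  by rewrite -rx -ry rr r2.
Qed.

Lemma injective_card_le (T U : Type) (f : T -> U) :
  injective f -> [set: T] #<= [set: U].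
Proof.
move=> f_inj; have E : f @` [set: T] #= [set: T].
  by apply: inj_card_eq => x y _ _; apply: f_inj.
by rewrite -(card_le_eql E); apply: card_leT.
Qed.

End Zorn.

(** * Prime ideals, maximal submonoids and complements of subspaces *)

Definition is_ideal (A : comNzRingType) (q : A -> Prop) :=
  [/\ q 0, forall a b, q a -> q b -> q (a - b) & forall a b, q b -> q (a * b)].

Definition is_prime (A : comNzRingType) (q : A -> Prop) :=
  [/\ is_ideal q, ~ q 1 & forall a b, q (a * b) -> q a \/ q b].

Section MaximalSubsets.
Local Open Scope classical_set_scope.

Definition is_submonoid (A : comNzRingType) (S : A -> Prop) :=
  S 1 /\ forall a b, S a -> S b -> S (a * b).

(** An ideal maximal among those disjoint from a submonoid is prime. The last clause records the
    maximality: the ideal generated by [q] and [a] meets [S]. For [S] reduced to 1 it says that [a]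
    is invertible modulo [q], so that [q] is a maximal ideal. *)
Lemma max_ideal_avoiding (A : comNzRingType) (S : A -> Prop) :
  is_submonoid S -> ~ S 0 ->
  exists q, [/\ is_prime q, forall a, q a -> ~ S a &
    forall a, ~ q a -> exists u s, S s /\ q (s - u * a)].
Proof.
move=> [S1 SM] S0.
pose P (q : set A) := is_ideal q /\ forall a, q a -> ~ S a.
have [||q [[[q0 qB qM] qS] _ qmax]] := @Zorn_above A P [set 0].
- split; last by move=> a ->.
  split=> // [a b -> ->|a b ->]; rewrite ?subr0 ?mulr0 //.
- move=> F FP Ftot [Y FY]; split; last by move=> a [X /FP[_]]; apply.
  split.
  + by exists Y => //; case: (FP _ FY) => -[].
  + move=> a b Fa Fb; have [X [FX Xa Xb]] := total_on_pair Ftot Fa Fb.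
    by exists X => //; case: (FP _ FX) => -[_ h _] _; apply: h.
  + move=> a b [X FX Xb]; exists X => //.
    by case: (FP _ FX) => -[_ _ h] _; apply: h.
have qN a : q a -> q (- a) by move=> qa; rewrite -sub0r; apply: qB.
have qD a b : q a -> q b -> q (a + b).
  by move=> qa qb; rewrite -[b]opprK; apply: qB => //; apply: qN.
have key a : ~ q a -> exists u s, S s /\ q (s - u * a).
  move=> nqa; apply: contrapT => none.
  pose q' : set A := fun b => exists u r, q r /\ b = u * a + r.
  apply: nqa; apply: (qmax q').
  - split.
    + split.
      * by exists 0, 0; rewrite mul0r addr0.
      * move=> _ _ [u [r [qr ->]]] [v [s [qs ->]]]; exists (u - v), (r - s).
        by split; [apply: qB|rewrite mulrBl opprD addrACA].
      * move=> b _ [u [r [qr ->]]]; exists (b * u), (b * r).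
        by split; [apply: qM|rewrite mulrDr mulrA].
    + move=> b [u [r [qr ->]]] Sb; apply: none; exists u, (u * a + r).
      by split=> //; rewrite addrAC subrr add0r.
  - by move=> r qr; exists 0, r; rewrite mul0r add0r.
  - by exists 1, 0; rewrite mul1r addr0.
exists q; split=> //; split=> // [/qS/(_ S1)//|a b qab].
apply: contrapT => /not_orP[/key[u [s [Ss qa]]] /key[v [t [St qb]]]].
apply: (qS (s * t) _ (SM _ _ Ss St)).
(* Each of the three summands lies in [q], whereas [s * t] lies in [S]. *)
have -> : s * t = (s - u * a) * t + u * a * (t - v * b) + u * v * (a * b).
  rewrite mulrBl mulrBr [u * a * (v * b)]mulrACA !addrA.
  by rewrite -[s * t - _ + _]addrA addNr addr0 subrK.
by apply: (qD); [apply: (qD)|]; [rewrite mulrC| |]; apply: qM.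
Qed.

(* In terms of prime ideals: the complement of M is a minimal prime over N. *)
Definition is_max_submonoid (A : comNzRingType) (N M : A -> Prop) :=
  [/\ is_submonoid M, forall a, M a -> ~ N a &
      forall a, ~ M a -> exists m n, M m /\ N (m * a ^+ n)].

(** For [a] outside a maximal [M], the products [m * a ^+ n] form a strictly larger submonoid, which
    therefore meets [N]. *)
Lemma max_submonoid_exists (A : comNzRingType) (N : A -> Prop) :
  ~ N 1 -> exists M, is_max_submonoid N M.
Proof.
move=> N1; pose P (M : set A) := is_submonoid M /\ forall a, M a -> ~ N a.
have [||M [[[M1 MM] MN] _ Mmax]] := @Zorn_above A P [set 1].
- by split=> [|a -> //]; split=> // a b -> ->; rewrite mulr1.
- move=> F FP Ftot [Y FY]; split; last by move=> a [X /FP[_]]; apply.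
  split; first by exists Y => //; case: (FP _ FY) => -[].
  move=> a b Fa Fb; have [X [FX Xa Xb]] := total_on_pair Ftot Fa Fb.
  by exists X => //; case: (FP _ FX) => -[_ h] _; apply: h.
exists M; split=> // a nMa; apply: contrapT => none; apply: nMa.
apply: (Mmax (fun b => exists m n, M m /\ b = m * a ^+ n)).
- split=> [|_ [m [n [Mm ->]]] Nmn]; last by apply: none; exists m, n.
  split; first by exists 1, 0; rewrite mul1r expr0.
  move=> _ _ [m [n [Mm ->]]] [m' [n' [Mm' ->]]]; exists (m * m'), (n + n')%N.
  by rewrite mulrACA exprD; split=> //; apply: MM.
- by move=> m Mm; exists m, 0; rewrite expr0 mulr1.
- by exists 1, 1%N; rewrite expr1 mul1r.
Qed.

Definition is_linear (k : fieldType) (V W : lmodType k) (x : V -> W) :=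
  forall c a b, x (c *: a + b) = c *: x a + x b.

Definition is_subspace (k : fieldType) (V : lmodType k) (U : V -> Prop) :=
  U 0 /\ forall c a b, U a -> U b -> U (c *: a + b).

(** A subspace [W] maximal among those meeting [U] trivially is a complement of [U]: a vector
    outside [U + W] could be added to [W]. Then [pi] is the projection along [W]. *)
Lemma subspace_projection (k : fieldType) (V : lmodType k) (U : V -> Prop) :
  is_subspace U ->
  exists pi : V -> V,
    [/\ is_linear pi, forall a, U (pi a) & forall a, U a -> pi a = a].
Proof.
move=> [U0 UZ]; pose P (W : set V) := is_subspace W /\ forall a, W a -> U a -> a = 0.
have [||W [[[W0 WZ] WU] _ Wmax]] := @Zorn_above V P [set 0].
- by split=> [|a ->//]; split=> // c a b -> ->; rewrite scaler0 addr0.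
- move=> F FP Ftot [Y FY]; split; last by move=> a [X /FP[_]]; apply.
  split; first by exists Y => //; case: (FP _ FY) => -[].
  move=> c a b Fa Fb; have [X [FX Xa Xb]] := total_on_pair Ftot Fa Fb.
  by exists X => //; case: (FP _ FX) => -[_ h] _; apply: h.
have WB a b : W a -> W b -> W (a - b).
  by move=> Wa Wb; rewrite addrC -scaleN1r; apply: WZ.
have UB a b : U a -> U b -> U (a - b).
  by move=> Wa Wb; rewrite addrC -scaleN1r; apply: UZ.
have dec v : exists u, U u /\ W (v - u).
  apply: contrapT => none; have [u|] := pselect (exists u w, U u /\ W w /\ v = u + w).
    case: u => u [w [Uu [Ww E]]]; apply: none; exists u; split=> //.
    by rewrite E addrAC subrr add0r.
  move=> nv; apply: nv; exists 0, v; split=> //; split; last by rewrite add0r.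
  apply: (Wmax (fun w => exists c w', W w' /\ w = c *: v + w')).
  - split; first split.
    + by exists 0, 0; rewrite scale0r addr0.
    + move=> c _ _ [a [w [Ww ->]]] [b [w' [Ww' ->]]].
      exists (c * a + b), (c *: w + w'); split; first exact: WZ.
      by rewrite scalerDr scalerA scalerDl addrACA.
    + move=> _ [c [w [Ww ->]]] Ucw; have [c0|c0] := eqVneq c 0.
        by move: Ucw; rewrite c0 scale0r add0r; apply: WU.
      case: none; exists (c^-1 *: (c *: v + w)); split.
        by rewrite -[X in U X]addr0; apply: UZ.
      rewrite scalerDr scalerA mulVf // scale1r opprD addrA subrr sub0r.
      by rewrite -sub0r; apply: WB => //; rewrite -[X in W X]addr0; apply: WZ.
  - by move=> w Ww; exists 0, w; rewrite scale0r add0r.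
  - by exists 1, 0; rewrite scale1r addr0.
have [pi piP] := choice dec.
have uniq v u : U u -> W (v - u) -> pi v = u.
  move=> Uu Wu; have [Up Wp] := piP v; apply/eqP; rewrite -subr_eq0; apply/eqP.
  apply: WU; last exact: UB.
  have -> : pi v - u = (v - u) - (v - pi v) by rewrite opprB [RHS]addrC addrA subrK.
  exact: WB.
exists pi; split=> [c a b|a|a Ua]; first last.
- by apply: uniq => //; rewrite subrr.
- by case: (piP a).
apply: uniq; first by apply: UZ; [case: (piP a)|case: (piP b)].
rewrite opprD addrACA -scalerBr.
by apply: WZ; [case: (piP a)|case: (piP b)].
Qed.
End MaximalSubsets.

(** * Residue field of a prime ideal *)

Section ResidueField.
Variables (A : comNzRingType) (q : A -> Prop) (q_prime : is_prime q).

Definition prime_pred : {pred A} := fun a => `[< q a >].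

Fact prime_predP a : reflect (q a) (a \in prime_pred).
Proof. exact: asboolP. Qed.

Fact prime_pred_idealr : idealr_closed prime_pred.
Proof.
case: q_prime => -[q0 qB qM] q1 _; split; first exact/prime_predP.
  by apply/prime_predP.
move=> a u v /prime_predP qu /prime_predP qv; apply/prime_predP.
rewrite -[v]opprK -[- v]sub0r; apply: (qB); first exact: qM.
by apply: qB.
Qed.

Fact prime_pred_prime : prime_idealr_closed prime_pred.
Proof.
case: q_prime => _ _ qP u v /prime_predP /qP[] /prime_predP ->; rewrite ?orbT //.
Qed.

HB.instance Definition _ := isIdealr.Build A prime_pred prime_pred_idealr.
HB.instance Definition _ := isPrimeIdealrClosed.Build A prime_pred prime_pred_prime.

Definition quot_prime := {ideal_quot (prime_pred : prime_idealr A)}.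
HB.instance Definition _ := GRing.ComNzRing.on quot_prime.

(** Fractions are formed over an integral domain equipped with a unit predicate and an inverse; here
    both are chosen classically. *)
Definition quot_prime_unit : pred quot_prime := fun x => `[< exists y, y * x = 1 >].
Definition quot_prime_inv (x : quot_prime) : quot_prime :=
  if pselect (exists y, y * x = 1) is left h then projT1 (cid h) else x.

Fact quot_prime_mulVx : {in quot_prime_unit, left_inverse 1 quot_prime_inv *%R}.
Proof.
move=> x /asboolP h; rewrite /quot_prime_inv; case: pselect => // h'.
by case: cid.
Qed.
Fact quot_prime_unitPl (x y : quot_prime) : y * x = 1 -> quot_prime_unit x.
Proof. by move=> h; apply/asboolP; exists y. Qed.
Fact quot_prime_inv_out : {in [predC quot_prime_unit], quot_prime_inv =1 id}.
Proof.
move=> x /negP nx; rewrite /quot_prime_inv; case: pselect => // h.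
by case: nx; apply/asboolP.
Qed.
HB.instance Definition _ := GRing.ComNzRing_hasMulInverse.Build quot_prime
  quot_prime_mulVx quot_prime_unitPl quot_prime_inv_out.
HB.instance Definition _ := GRing.ComUnitRing_isIntegral.Build quot_prime
  (@Quotient.rquot_IdomainAxiom A prime_pred).

Lemma residue_field : exists (K : fieldType) (pi : {rmorphism A -> K}),
  forall a, pi a = 0 <-> q a.
Proof.
exists {fraction quot_prime}.
pose f : {rmorphism A -> quot_prime} := \pi_quot_prime%qT.
exists (@FracField.tofrac _ \o f) => a /=.
have E : (f a == 0) = (a \in prime_pred).
  by rewrite -(rmorph0 f) /f -Quotient.idealrBE subr0.
split=> [/eqP|/prime_predP].
  by rewrite tofrac_eq0 E => /prime_predP.
by rewrite -E => /eqP ->; rewrite tofrac0.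
Qed.
End ResidueField.

(** * Extending homomorphisms to an algebraically closed field *)

Lemma min_size_poly (R : nzRingType) (P : {poly R} -> Prop) p0 :
  P p0 -> exists p, P p /\ forall q, P q -> (size p <= size q)%N.
Proof.
move=> Pp0; have ex : exists n, `[< exists p, P p /\ size p = n >].
  by exists (size p0); apply/asboolP; exists p0.
case: (ex_minnP ex) => n /asboolP[p [Pp <-]] nmin; exists p; split=> // q Pq.
by apply: nmin; apply/asboolP; exists q.
Qed.

(** For non-constant [p], a root of [p - 1] is not a root of [p]. *)
Lemma closed_field_nonroot (k : closedFieldType) (p : {poly k}) :
  p != 0 -> exists a, p.[a] != 0.
Proof.
move=> p0; have [s1|s1] := eqVneq (size p) 1%N.
  exists 0; rewrite (size1_polyC (eq_leq s1)) hornerC.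
  by move: p0; rewrite {1}(size1_polyC (eq_leq s1)) polyC_eq0.
have /closed_rootP[a] : size (p - 1) != 1%N.
  rewrite size_polyDl // size_polyN size_poly1 ltn_neqAle eq_sym s1.
  by rewrite lt0n size_poly_eq0.
by rewrite rootE !hornerE subr_eq0 => /eqP pa; exists a; rewrite pa oner_neq0.
Qed.

Section Extension.
Variables (k : closedFieldType) (K : fieldType) (iota : {rmorphism k -> K}).
Implicit Types (C : K -> Prop) (x : K -> k) (p q f g h : {poly K}).

Definition is_subalg C :=
  [/\ forall c, C (iota c), forall a b, C a -> C b -> C (a - b) &
      forall a b, C a -> C b -> C (a * b)].

(** Points of a subalgebra [C] of [K] are total functions on [K] whose values outside [C] are
    immaterial, so extending a point to a larger subalgebra does not change its type. *)
Definition is_hom_on C x :=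
  [/\ forall c, x (iota c) = c,
      forall a b, C a -> C b -> x (a - b) = x a - x b &
      forall a b, C a -> C b -> x (a * b) = x a * x b].

Definition poly_in C p := forall i, C p`_i.

Definition adjoin1 C t : K -> Prop := fun e => exists p, poly_in C p /\ e = p.[t].

Section Subalg.
Variables (C : K -> Prop) (C_subalg : is_subalg C).

Lemma subalg0 : C 0.
Proof. by case: C_subalg => + _ _ => /(_ 0); rewrite rmorph0. Qed.

Lemma subalg1 : C 1.
Proof. by case: C_subalg => + _ _ => /(_ 1); rewrite rmorph1. Qed.

Lemma subalgB a b : C a -> C b -> C (a - b).
Proof. by case: C_subalg => _ + _; apply. Qed.

Lemma subalgM a b : C a -> C b -> C (a * b).
Proof. by case: C_subalg => _ _; apply. Qed.

Lemma subalgN a : C a -> C (- a).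
Proof. by rewrite -sub0r; apply: subalgB subalg0. Qed.

Lemma subalgD a b : C a -> C b -> C (a + b).
Proof. by move=> Ca Cb; rewrite -[b]opprK; apply/subalgB/subalgN. Qed.

Lemma subalgX a n : C a -> C (a ^+ n).
Proof.
move=> Ca; elim: n => [|n IH]; first by rewrite expr0; apply: subalg1.
by rewrite exprS; apply: subalgM.
Qed.

Lemma subalg_sum (J : Type) (r : seq J) (P : pred J) F :
  (forall i, P i -> C (F i)) -> C (\sum_(i <- r | P i) F i).
Proof. by move=> CF; apply: big_ind => //; [apply: subalg0|apply: subalgD]. Qed.

Lemma poly_inC a : C a -> poly_in C a%:P.
Proof. by move=> Ca i; rewrite coefC; case: eqP => // _; apply: subalg0. Qed.

Lemma poly_inXn n : poly_in C 'X^n.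
Proof. by move=> i; rewrite coefXn; case: eqP; [move=> _; apply: subalg1|move=> _; apply: subalg0]. Qed.

Lemma poly_inB p q : poly_in C p -> poly_in C q -> poly_in C (p - q).
Proof. by move=> Cp Cq i; rewrite coefB; apply: subalgB. Qed.

Lemma poly_inD p q : poly_in C p -> poly_in C q -> poly_in C (p + q).
Proof. by move=> Cp Cq i; rewrite coefD; apply: subalgD. Qed.

Lemma poly_inM p q : poly_in C p -> poly_in C q -> poly_in C (p * q).
Proof. by move=> Cp Cq i; rewrite coefM; apply: subalg_sum => j _; apply: subalgM. Qed.

Lemma poly_inZ a p : C a -> poly_in C p -> poly_in C (a *: p).
Proof. by move=> Ca Cp i; rewrite coefZ; apply: subalgM. Qed.

Lemma adjoin1_subalg t : is_subalg (adjoin1 C t).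
Proof.
split=> [c|_ _ [p [Cp ->]] [q [Cq ->]]|_ _ [p [Cp ->]] [q [Cq ->]]].
- exists (iota c)%:P; rewrite hornerC; split=> //; apply: poly_inC.
  by case: C_subalg.
- by exists (p - q); rewrite hornerD hornerN; split=> //; apply: poly_inB.
- by exists (p * q); rewrite hornerM; split=> //; apply: poly_inM.
Qed.

Lemma sub_adjoin1 t e : C e -> adjoin1 C t e.
Proof. by move=> Ce; exists e%:P; rewrite hornerC; split=> //; apply: poly_inC. Qed.

Lemma mem_adjoin1 t : adjoin1 C t t.
Proof.
by exists 'X; rewrite hornerX -['X]expr1; split=> //; apply: poly_inXn.
Qed.

(** The leading coefficient of [g] need not be invertible in [C], so each cancellation of a leading
    term costs one factor [lead_coef g]. *)
Lemma pseudo_division g : poly_in C g -> g != 0 -> forall h, poly_in C h ->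
  exists n q r, [/\ poly_in C q, poly_in C r,
    lead_coef g ^+ n *: h = q * g + r & (size r < size g)%N].
Proof.
move=> Cg g0 h; move: {2}(size h) (leqnn (size h)) => m.
elim: m h => [|m IH] h hm Ch.
  exists 0, 0, 0; split; try by rewrite -[0]/(0%:P); apply/poly_inC/subalg0.
    by move: hm; rewrite leqn0 size_poly_eq0 => /eqP->; rewrite scaler0 mul0r addr0.
  by rewrite size_poly0 lt0n size_poly_eq0.
have [hg|gh] := ltnP (size h) (size g).
  exists 0, 0, h; split=> //; last by rewrite expr0 scale1r mul0r add0r.
  by rewrite -[0]/(0%:P); apply/poly_inC/subalg0.
have h0 : h != 0 by rewrite -size_poly_gt0; apply: leq_trans gh; rewrite size_poly_gt0.
pose u := lead_coef h *: 'X^(size h - size g).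
have Cu : poly_in C u by apply: poly_inZ; [apply: Ch|apply: poly_inXn].
pose h' := lead_coef g *: h - u * g.
have Ch' : poly_in C h'.
  by apply: poly_inB; [apply: poly_inZ => //; apply: Cg|apply: poly_inM].
have sug : size (u * g) = size h.
  have su : size u = (size h - size g).+1 by rewrite size_scale ?lead_coef_eq0 // size_polyXn.
  by rewrite size_mul // -?size_poly_eq0 su // addSn subnK.
have hm' : (size h' <= m)%N.
  rewrite -ltnS; apply: leq_trans hm; rewrite ltn_neqAle.
  have le : (size h' <= size h)%N.
    apply: leq_trans (size_polyD _ _) _.
    by rewrite size_polyN sug size_scale ?lead_coef_eq0 // maxnn.
  rewrite le andbT; apply: contra_neq h0 => E.
  have : lead_coef h' = 0.
    rewrite /lead_coef E coefB coefZ -/(lead_coef h) -{1}sug -lead_coefE.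
    by rewrite lead_coefM lead_coefZ lead_coefXn mulr1 mulrC subrr.
  by move/eqP; rewrite lead_coef_eq0 -size_poly_eq0 E size_poly_eq0 => /eqP.
have [n [q [r [Cq Cr E sr]]]] := IH _ hm' Ch'.
exists n.+1, (q + lead_coef g ^+ n *: u), r; split=> //.
  by apply: poly_inD => //; apply: poly_inZ => //; apply/subalgX/Cg.
rewrite exprSr -scalerA -[lead_coef g *: h](subrK (u * g)) -/h' scalerDr E.
by rewrite addrAC scalerAl -mulrDl.
Qed.

Section Hom.
Variables (x : K -> k) (x_hom : is_hom_on C x).

Lemma hom_on0 : x 0 = 0.
Proof. by case: x_hom => + _ _ => /(_ 0); rewrite rmorph0. Qed.

Lemma hom_on1 : x 1 = 1.
Proof. by case: x_hom => + _ _ => /(_ 1); rewrite rmorph1. Qed.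

Lemma hom_onB a b : C a -> C b -> x (a - b) = x a - x b.
Proof. by case: x_hom => _ + _; apply. Qed.

Lemma hom_onM a b : C a -> C b -> x (a * b) = x a * x b.
Proof. by case: x_hom => _ _; apply. Qed.

Lemma hom_onD a b : C a -> C b -> x (a + b) = x a + x b.
Proof.
move=> Ca Cb; rewrite -{1}[b]opprK hom_onB //; last exact: subalgN.
by rewrite -[- b]sub0r hom_onB ?hom_on0 ?sub0r ?opprK //; apply: subalg0.
Qed.

Lemma hom_onX a n : C a -> x (a ^+ n) = x a ^+ n.
Proof.
move=> Ca; elim: n => [|n IH]; first by rewrite !expr0 hom_on1.
by rewrite !exprS hom_onM ?IH //; apply: subalgX.
Qed.

Lemma hom_on_sum (J : Type) (r : seq J) F :
  (forall i, C (F i)) -> x (\sum_(i <- r) F i) = \sum_(i <- r) x (F i).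
Proof.
move=> CF; elim: r => [|i r IH]; first by rewrite !big_nil hom_on0.
by rewrite !big_cons hom_onD ?IH //; apply: subalg_sum.
Qed.

Local Notation "p ^x" := (map_poly x p) (at level 2, format "p ^x").

Lemma coef_map_on p i : p^x`_i = x p`_i.
Proof. by rewrite coef_map_id0 // hom_on0. Qed.

Lemma map_onB p q : poly_in C p -> poly_in C q -> (p - q)^x = p^x - q^x.
Proof.
by move=> Cp Cq; apply/polyP => i; rewrite coefB !coef_map_on coefB hom_onB.
Qed.

Lemma map_onD p q : poly_in C p -> poly_in C q -> (p + q)^x = p^x + q^x.
Proof.
by move=> Cp Cq; apply/polyP => i; rewrite coefD !coef_map_on coefD hom_onD.
Qed.

Lemma map_onM p q : poly_in C p -> poly_in C q -> (p * q)^x = p^x * q^x.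
Proof.
move=> Cp Cq; apply/polyP => i; rewrite coefM coef_map_on coefM hom_on_sum.
  by apply: eq_bigr => j _; rewrite hom_onM // !coef_map_on.
by move=> j; apply: subalgM.
Qed.

Lemma map_onZ a p : C a -> poly_in C p -> (a *: p)^x = x a *: p^x.
Proof.
by move=> Ca Cp; apply/polyP => i; rewrite coefZ !coef_map_on coefZ hom_onM.
Qed.

Lemma map_onC a : a%:P^x = (x a)%:P.
Proof.
apply/polyP => i; rewrite coef_map_on !coefC; case: eqP => // _.
exact: hom_on0.
Qed.

(** Two polynomials with the same value at [t] differ by one vanishing at [t]; the hypothesis thus
    makes it well defined to send [h.[t]] to the value at [tau] of the image of [h]. *)
Lemma hom_adjoin1 t tau :
    (forall h, poly_in C h -> h.[t] = 0 -> h^x.[tau] = 0) ->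
  exists x', [/\ is_hom_on (adjoin1 C t) x', forall e, C e -> x' e = x e &
    forall h, poly_in C h -> x' h.[t] = h^x.[tau]].
Proof.
move=> tauP.
have [x' x'P] : {x' : K -> k & forall h, poly_in C h -> x' h.[t] = h^x.[tau]}.
  pose R e v := forall h, poly_in C h -> e = h.[t] -> v = h^x.[tau].
  have : forall e, exists v, R e v.
    move=> e; have [[h [Ch eh]]|ne] := pselect (adjoin1 C t e); last first.
      by exists 0 => h Ch eh; case: ne; exists h.
    exists h^x.[tau] => h' Ch' eh'; apply/eqP; rewrite -subr_eq0 -hornerN -hornerD.
    by rewrite -map_onB // tauP ?hornerD ?hornerN -?eh -?eh' ?subrr //; apply: poly_inB.
  by move=> /choice[x' x'P]; exists x' => h Ch; apply: x'P.
have x'C e : C e -> x' e = x e.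
  move=> Ce; rewrite -[e in LHS](hornerC e t) x'P; last exact: poly_inC.
  by rewrite map_onC hornerC.
exists x'; split=> //; split.
- move=> c; rewrite x'C; first by case: x_hom.
  by case: C_subalg.
- move=> _ _ [p [Cp ->]] [q [Cq ->]]; rewrite -hornerN -hornerD !x'P ?map_onB //.
    by rewrite hornerD hornerN.
  exact: poly_inB.
- move=> _ _ [p [Cp ->]] [q [Cq ->]]; rewrite -hornerM !x'P ?map_onM ?hornerM //.
  exact: poly_inM.
Qed.

End Hom.

(** Algebraic form of the fact that a dominant morphism of finite type hits a nonempty open set. Let
    [b = f.[t]]. If [t] is transcendental over [C], then [a] is the leading coefficient of [f], and
    [t] is sent to any non-root of the image of [f]. If [t] is a root of a nonzero [g] of minimal
    degree, then [t] is sent to a root of the image of [g], and [a] is the leading coefficient of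
    [g] times a nonzero constant of the ideal [(f, g)]. *)
Lemma extend_adjoin1 t b : adjoin1 C t b -> b != 0 ->
  exists a, [/\ C a, a != 0 & forall x, is_hom_on C x -> x a != 0 ->
    exists x', [/\ is_hom_on (adjoin1 C t) x',
      forall e, C e -> x' e = x e & x' b != 0]].
Proof.
move=> [f [Cf ->]] b0; have f0 : f != 0.
  by apply: contra_neq b0 => ->; rewrite horner0.
pose root_t g := [/\ poly_in C g, g != 0 & g.[t] = 0].
have [alg|trans] := pselect (exists g, root_t g); last first.
  exists (lead_coef f); split; [exact: Cf|by rewrite lead_coef_eq0|].
  move=> x x_hom xa; have /closed_field_nonroot[tau tauP] : map_poly x f != 0.
    apply: contra_neq xa => E; have := coef_map_on x_hom f (size f).-1.
    by rewrite E coef0 -lead_coefE.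
  have [h Ch ht|x' [hx' ext x'P]] := hom_adjoin1 x_hom (t := t) (tau := tau).
    have [->|h0] := eqVneq h 0; last by case: trans; exists h.
    by rewrite -[0]/(0%:P) map_onC // hornerC hom_on0.
  by exists x'; rewrite x'P.
have [p0 Pp0] := alg; have {p0 Pp0} [g [[Cg g0 gt] gmin]] := @min_size_poly _ root_t _ Pp0.
(* A nonzero element of minimal degree in the ideal (f, g) is a constant. *)
pose J h := [/\ h != 0 & exists u v,
  [/\ poly_in C u, poly_in C v & h = u * f + v * g]].
have [|h [[h0 [u [v [Cu Cv hE]]]] hmin]] := @min_size_poly _ J g.
  split=> //; exists 0, 1; rewrite mul0r add0r mul1r; split=> //.
    by rewrite -[0]/(0%:P); apply/poly_inC/subalg0.
  exact/poly_inC/subalg1.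
have Ch : poly_in C h by rewrite hE; apply: poly_inD; apply: poly_inM.
have Jdvd p : poly_in C p ->
    (exists u v, [/\ poly_in C u, poly_in C v & p = u * f + v * g]) ->
    exists n q, [/\ poly_in C q & lead_coef h ^+ n *: p = q * h].
  move=> Cp [u' [v' [Cu' Cv' pE]]].
  have [n [q [r [Cq Cr E sr]]]] := pseudo_division Ch h0 Cp.
  exists n, q; split=> //; rewrite E.
  have [->|r0] := eqVneq r 0; first by rewrite addr0.
  have ln : C (lead_coef h ^+ n) by apply/subalgX/Ch.
  have /hmin : J r.
    split=> //; exists (lead_coef h ^+ n *: u' - q * u), (lead_coef h ^+ n *: v' - q * v).
    split; try by apply: poly_inB; [apply: poly_inZ|apply: poly_inM].
    rewrite !mulrBl addrACA -opprD -!scalerAl -scalerDr -pE E -!mulrA -mulrDr -hE.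
    by rewrite addrAC subrr add0r.
  by rewrite leqNgt sr.
have lh0 : lead_coef h != 0 by rewrite lead_coef_eq0.
have [||n [q [Cq Eq]]] := Jdvd g => //.
  exists 0, 1; rewrite mul0r add0r mul1r; split=> //.
    by rewrite -[0]/(0%:P); apply/poly_inC/subalg0.
  exact/poly_inC/subalg1.
have [||m [q' [Cq' Eq']]] := Jdvd f => //.
  exists 1, 0; rewrite mul0r addr0 mul1r; split=> //; last first.
    by rewrite -[0]/(0%:P); apply/poly_inC/subalg0.
  exact/poly_inC/subalg1.
(* Up to a nonzero constant, [f] is a multiple of [h], and [f] does not vanish at [t]. *)
have ht : h.[t] != 0.
  apply: contra_neq b0 => ht; have := congr1 (horner^~ t) Eq'.
  rewrite hornerZ hornerM ht mulr0 => /eqP.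
  by rewrite mulf_eq0 expf_eq0 (negPf lh0) andbF => /eqP.
have q0 : q != 0.
  apply: contra_neq g0 => q0; move: Eq; rewrite q0 mul0r => /eqP.
  by rewrite scaler_eq0 expf_eq0 (negPf lh0) andbF => /eqP.
have qt : q.[t] = 0.
  have := congr1 (horner^~ t) Eq; rewrite hornerZ hornerM gt mulr0 => /esym/eqP.
  by rewrite mulf_eq0 (negPf ht) orbF => /eqP.
(* Up to a nonzero constant [g] is [q * h], and [q] vanishes at [t] because [h] does not. By
   minimality of [g], the degree of [q] is at least that of [g], which leaves degree 0 for [h]. *)
have sh : size h = 1%N.
  have := congr1 (size \o @polyseq _) Eq.
  rewrite /= size_scale ?expf_neq0 // size_mul // => E.
  have := gmin q (And3 Cq q0 qt); rewrite E.
  case: (size h) (size_poly_gt0 h) (size_poly_gt0 q) => [|[|s]]; rewrite ?h0 ?q0 //.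
  by move=> _ _; rewrite !addnS /= ltnNge leq_addr.
have hC := size1_polyC (eq_leq sh).
(* The first factor keeps the degree of [g] under [x], so that the image of [g] has a root; the
   second prevents the images of [f] and [g] from having a common root. *)
exists (lead_coef g * h`_0); split.
- by apply: subalgM; [apply: Cg|apply: Ch].
- rewrite mulf_neq0 ?lead_coef_eq0 //.
  by apply: contra_neq h0 => E; rewrite hC E.
move=> x x_hom; rewrite hom_onM; [|by []|exact: Cg|exact: Ch].
rewrite mulf_eq0 negb_or => /andP[xg xh].
have szg : size (map_poly x g) = size g by rewrite size_map_poly_id0.
have /closed_rootP[tau /rootP gtau] : size (map_poly x g) != 1%N.
  rewrite szg; apply: contra_neq g0 => sg.
  move: gt; rewrite (size1_polyC (eq_leq sg)) hornerC => ->.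
  by rewrite polyC0.
(* By minimality of [g], pseudo-division of a polynomial vanishing at [t] leaves remainder 0, so the
   image of this polynomial vanishes at the root [tau]. *)
have [p Cp pt|x' [hx' ext x'P]] := hom_adjoin1 x_hom (t := t) (tau := tau).
  have [n' [q'' [r [Cq'' Cr E sr]]]] := pseudo_division Cg g0 Cp.
  have r0 : r = 0.
    apply/eqP/contraT => r0.
    have rt : r.[t] = 0.
      have := congr1 (horner^~ t) E; rewrite hornerZ hornerD hornerM pt gt.
      by rewrite !mulr0 add0r.
    by move: (gmin r (And3 Cr r0 rt)); rewrite leqNgt sr.
  have Cln : C (lead_coef g ^+ n') by apply/subalgX/Cg.
  have := congr1 (fun p => (map_poly x p).[tau]) E.
  rewrite r0 addr0 map_onZ // map_onM // hornerM gtau mulr0 hornerZ (hom_onX x_hom); last exact: Cg.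
  by move=> /eqP; rewrite mulf_eq0 expf_eq0 (negPf xg) andbF => /eqP.
exists x'; split=> //; rewrite x'P //.
apply: contra_neq xh => ftau.
have := congr1 (fun p => (map_poly x p).[tau]) hE.
rewrite map_onD ?map_onM //; try exact: poly_inM.
rewrite hornerD !hornerM ftau gtau !mulr0 addr0.
by rewrite {1}hC map_onC // hornerC.
Qed.

End Subalg.

Fixpoint adjoin C (s : seq K) : K -> Prop :=
  if s is t :: s' then adjoin (adjoin1 C t) s' else C.

Lemma adjoin_subalg C s : is_subalg C -> is_subalg (adjoin C s).
Proof. by elim: s C => //= t s IH C CC; apply/IH/adjoin1_subalg. Qed.

Lemma sub_adjoin C s e : is_subalg C -> C e -> adjoin C s e.
Proof.
elim: s C => //= t s IH C CC Ce.
by apply: IH; [apply: adjoin1_subalg|apply: sub_adjoin1].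
Qed.

Lemma mem_adjoin C s e : is_subalg C -> e \in s -> adjoin C s e.
Proof.
elim: s C => //= t s IH C CC; rewrite inE => /orP[/eqP->|es].
  by apply: sub_adjoin; [apply: adjoin1_subalg|apply: mem_adjoin1].
by apply: IH => //; apply: adjoin1_subalg.
Qed.

Lemma extend_adjoin C s b : is_subalg C -> adjoin C s b -> b != 0 ->
  exists a, [/\ C a, a != 0 & forall x, is_hom_on C x -> x a != 0 ->
    exists x', [/\ is_hom_on (adjoin C s) x',
      forall e, C e -> x' e = x e & x' b != 0]].
Proof.
elim: s C b => [|t s IH] C b CC /= Cb b0.
  by exists b; split=> // x x_hom xb; exists x.
have CtC := adjoin1_subalg CC t.
have [a [Ca a0 aP]] := IH _ _ CtC Cb b0.
have [a' [Ca' a'0 a'P]] := extend_adjoin1 CC Ca a0.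
exists a'; split=> // x x_hom xa'.
have [x1 [x1_hom x1E x1a]] := a'P _ x_hom xa'.
have [x2 [x2_hom x2E x2b]] := aP _ x1_hom x1a.
exists x2; split=> // e Ce; rewrite x2E ?x1E //.
exact: sub_adjoin1.
Qed.

Definition scalars : K -> Prop := fun e => exists c, e = iota c.

Lemma scalars_subalg : is_subalg scalars.
Proof.
split=> [c|_ _ [a ->] [b ->]|_ _ [a ->] [b ->]]; first by exists c.
  by exists (a - b); rewrite rmorphB.
by exists (a * b); rewrite rmorphM.
Qed.

Lemma scalars_retraction : exists x, is_hom_on scalars x /\ cancel iota x.
Proof.
have [x xP] : {x : K -> k & cancel iota x}.
  have : forall e, exists c, forall c', e = iota c' -> c' = c.
    move=> e; have [[c' ->]|ne] := pselect (scalars e).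
      by exists c' => c'' /fmorph_inj.
    by exists 0 => c' E; case: ne; exists c'.
  by move=> /choice[x xP]; exists x => c'; apply/esym/xP.
exists x; split=> //; split=> // [_ _ [u ->] [v ->]|_ _ [u ->] [v ->]].
  by rewrite -rmorphB !xP.
by rewrite -rmorphM !xP.
Qed.

(** Over the scalars the element [a] given by [extend_adjoin] is a nonzero constant, so the
    condition [x a != 0] is automatic. *)
Lemma weak_nullstellensatz s b : adjoin scalars s b -> b != 0 ->
  exists x, is_hom_on (adjoin scalars s) x /\ x b != 0.
Proof.
move=> Cb b0; have [a [[c ->] a0 aP]] := extend_adjoin scalars_subalg Cb b0.
have [x [x_hom xP]] := scalars_retraction.
have [|x' [? _ ?]] := aP x x_hom; last by exists x'.
by rewrite xP; apply: contra_neq a0 => ->; rewrite rmorph0.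
Qed.

End Extension.

(** * Algebras presented by generators and relations *)

Section LRMorphisms.
Variables (k : fieldType).
Implicit Types (A B R : comAlgType k).

(** Follows from function extensionality and proof irrelevance. Genuine equality is needed because
    group laws and actions take bundled morphisms as arguments. *)
Lemma lrmorphism_ext A R (f g : {lrmorphism A -> R}) : f =1 g -> f = g.
Proof.
case: f => f [[f1] [f2] [f3]]; case: g => g [[g1] [g2] [g3]] /= /funext E.
subst g; congr (GRing.LRMorphism.Pack (GRing.LRMorphism.Class _ _ _)).
- by congr (Algebra.isNmodMorphism.Axioms_ _); apply: Prop_irrelevance.
- by congr (GRing.isMonoidMorphism.Axioms_ _); apply: Prop_irrelevance.
- by congr (GRing.isScalable.Axioms_ _); apply: Prop_irrelevance.
Qed.

Definition mk_lrmorphism A R (f : A -> R) (f_lin : is_linear f) (f1 : f 1 = 1)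
    (fM : {morph f : a b / a * b}) : {lrmorphism A -> R} :=
  HB.pack_for {lrmorphism A -> R} f
    (GRing.isLinear.Build k A R *:%R f f_lin)
    (GRing.isMonoidMorphism.Build A R f (conj f1 fM)).

Lemma lrmorphism_linear A R (f : {lrmorphism A -> R}) : is_linear f.
Proof. exact: linearP. Qed.

End LRMorphisms.

Inductive term (k : fieldType) (X : Type) : Type :=
| Gen of X
| Cst of k
| Add of term k X & term k X
| Mul of term k X & term k X.
Arguments Gen {k X}.
Arguments Cst {k X}.

Fixpoint eval (k : fieldType) (X : Type) (R : comAlgType k) (f : X -> R)
    (t : term k X) : R :=
  match t with
  | Gen x => f x
  | Cst c => c%:A
  | Add s t => eval f s + eval f t
  | Mul s t => eval f s * eval f t
  end.

(* The model guarantees that the presented algebra is nonzero. *)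
Record presentation (k : fieldType) := Presentation {
  generator : Type;
  relation : term k generator -> term k generator -> Prop;
  model : comAlgType k;
  model_gen : generator -> model;
  model_relation : forall s t, relation s t -> eval model_gen s = eval model_gen t
}.

Section PresentedAlgebra.
Variables (k : fieldType) (P : presentation k).
Local Notation X := (generator P).
Local Notation tm := (term k X).

(** The congruence generated by the relations and the axioms of commutative [k]-algebras. Opposites
    are products with [Cst (-1)]. *)
Inductive eqv : tm -> tm -> Prop :=
| eqv_rel s t : relation s t -> eqv s t
| eqv_refl s : eqv s s
| eqv_sym s t : eqv s t -> eqv t s
| eqv_trans s t u : eqv s t -> eqv t u -> eqv s u
| eqv_add s s' t t' : eqv s s' -> eqv t t' -> eqv (Add s t) (Add s' t')
| eqv_mul s s' t t' : eqv s s' -> eqv t t' -> eqv (Mul s t) (Mul s' t')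
| eqv_addA s t u : eqv (Add s (Add t u)) (Add (Add s t) u)
| eqv_addC s t : eqv (Add s t) (Add t s)
| eqv_add0 s : eqv (Add (Cst 0) s) s
| eqv_mulA s t u : eqv (Mul s (Mul t u)) (Mul (Mul s t) u)
| eqv_mulC s t : eqv (Mul s t) (Mul t s)
| eqv_mul1 s : eqv (Mul (Cst 1) s) s
| eqv_mul0 s : eqv (Mul (Cst 0) s) (Cst 0)
| eqv_mulDl s t u : eqv (Mul (Add s t) u) (Add (Mul s u) (Mul t u))
| eqv_cstD a b : eqv (Cst (a + b)) (Add (Cst a) (Cst b))
| eqv_cstM a b : eqv (Cst (a * b)) (Mul (Cst a) (Cst b)).

Lemma eval_eqv (R : comAlgType k) (f : X -> R) :
  (forall s t, relation s t -> eval f s = eval f t) ->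
  forall s t, eqv s t -> eval f s = eval f t.
Proof.
move=> fP s t; elim=> //=.
- by move=> ? ? ? _ -> _ ->.
- by move=> ? ? ? ? _ -> _ ->.
- by move=> ? ? ? ? _ -> _ ->.
- by move=> *; rewrite addrA.
- by move=> *; rewrite addrC.
- by move=> *; rewrite scale0r add0r.
- by move=> *; rewrite mulrA.
- by move=> *; rewrite mulrC.
- by move=> *; rewrite scale1r mul1r.
- by move=> *; rewrite scale0r mul0r.
- by move=> *; rewrite mulrDl.
- by move=> *; rewrite scalerDl.
- by move=> *; rewrite -scalerAl mul1r scalerA.
Qed.

Definition presented := {c : tm -> Prop | exists t, c = eqv t}.
HB.instance Definition _ := gen_eqMixin presented.
HB.instance Definition _ := gen_choiceMixin presented.

Definition term_class (t : tm) : presented := exist _ (eqv t) (ex_intro _ t erefl).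
Definition term_rep (c : presented) : tm := projT1 (cid (proj2_sig c)).

Lemma term_classP s t : term_class s = term_class t <-> eqv s t.
Proof.
split=> [/(congr1 (@proj1_sig _ _)) /= E|st].
  by rewrite E; apply: eqv_refl.
apply: eq_exist; apply/funext => u; apply/propext; split=> h.
  exact: eqv_trans (eqv_sym st) h.
exact: eqv_trans st h.
Qed.

Lemma term_repK c : term_class (term_rep c) = c.
Proof.
rewrite /term_rep; case: cid => t; case: c => c c_class /= ct.
exact: eq_exist.
Qed.

Lemma eqv_term_rep t : eqv (term_rep (term_class t)) t.
Proof. by apply/term_classP; rewrite term_repK. Qed.

Lemma term_classW (Q : presented -> Prop) : (forall t, Q (term_class t)) -> forall c, Q c.
Proof. by move=> h c; rewrite -(term_repK c). Qed.

Definition padd (c d : presented) := term_class (Add (term_rep c) (term_rep d)).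
Definition pmul (c d : presented) := term_class (Mul (term_rep c) (term_rep d)).
Definition pscale (a : k) (c : presented) := term_class (Mul (Cst a) (term_rep c)).

Lemma paddE s t : padd (term_class s) (term_class t) = term_class (Add s t).
Proof. by apply/term_classP/eqv_add; apply: eqv_term_rep. Qed.
Lemma pmulE s t : pmul (term_class s) (term_class t) = term_class (Mul s t).
Proof. by apply/term_classP/eqv_mul; apply: eqv_term_rep. Qed.
Lemma pscaleE a t : pscale a (term_class t) = term_class (Mul (Cst a) t).
Proof. by apply/term_classP/eqv_mul; [apply: eqv_refl|apply: eqv_term_rep]. Qed.

Fact paddA : associative padd.
Proof.
do 3!elim/term_classW=> ?; rewrite !paddE; apply/term_classP; exact: eqv_addA.
Qed.
Fact paddC : commutative padd.
Proof. do 2!elim/term_classW=> ?; rewrite !paddE; apply/term_classP; exact: eqv_addC. Qed.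
Fact padd0 : left_id (term_class (Cst 0)) padd.
Proof. elim/term_classW=> ?; rewrite !paddE; apply/term_classP; exact: eqv_add0. Qed.

Fact pscaleDl c : {morph pscale^~ c : a b / a + b >-> padd a b}.
Proof.
elim/term_classW: c => t a b; rewrite !pscaleE paddE; apply/term_classP.
apply: eqv_trans (eqv_mulDl _ _ _).
by apply: eqv_mul; [apply: eqv_cstD|apply: eqv_refl].
Qed.
Fact pscale1 : left_id 1 pscale.
Proof. elim/term_classW=> ?; rewrite !pscaleE; apply/term_classP; exact: eqv_mul1. Qed.

Fact paddN : left_inverse (term_class (Cst 0)) (pscale (-1)) padd.
Proof.
move=> c; rewrite -[c in padd _ c]pscale1 -pscaleDl addNr.
elim/term_classW: c => t; rewrite pscaleE; apply/term_classP; exact: eqv_mul0.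
Qed.
HB.instance Definition _ := GRing.isZmodule.Build presented paddA paddC padd0 paddN.

Fact pmulA : associative pmul.
Proof. do 3!elim/term_classW=> ?; rewrite !pmulE; apply/term_classP; exact: eqv_mulA. Qed.
Fact pmulC : commutative pmul.
Proof. do 2!elim/term_classW=> ?; rewrite !pmulE; apply/term_classP; exact: eqv_mulC. Qed.
Fact pmul1 : left_id (term_class (Cst 1)) pmul.
Proof. elim/term_classW=> ?; rewrite !pmulE; apply/term_classP; exact: eqv_mul1. Qed.
Fact pmulDl : left_distributive pmul +%R.
Proof.
do 3!elim/term_classW=> ?; rewrite /GRing.add /= !(pmulE, paddE); apply/term_classP.
exact: eqv_mulDl.
Qed.
Fact pone_neq0 : term_class (Cst 1) != 0.
Proof.
apply/eqP => /term_classP/(eval_eqv (@model_relation _ P))/= /eqP.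
by rewrite scale1r scale0r oner_eq0.
Qed.
HB.instance Definition _ := GRing.Zmodule_isComNzRing.Build presented
  pmulA pmulC pmul1 pmulDl pone_neq0.

Fact pscaleA a b c : pscale a (pscale b c) = pscale (a * b) c.
Proof.
elim/term_classW: c => t; rewrite !pscaleE; apply/term_classP.
apply: eqv_trans (eqv_mulA _ _ _) _; apply: eqv_mul; last exact: eqv_refl.
exact/eqv_sym/eqv_cstM.
Qed.
Fact pscaleDr : right_distributive pscale +%R.
Proof.
move=> a; do 2!elim/term_classW=> ?; rewrite /GRing.add /= !(paddE, pscaleE).
apply/term_classP; apply: eqv_trans (eqv_mulC _ _) _.
apply: eqv_trans (eqv_mulDl _ _ _) _; apply: eqv_add; exact: eqv_mulC.
Qed.
HB.instance Definition _ := GRing.Zmodule_isLmodule.Build k presented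
  pscaleA pscale1 pscaleDr pscaleDl.

Fact pscaleAl a (u v : presented) : a *: (u * v) = (a *: u) * v.
Proof.
elim/term_classW: u => s; elim/term_classW: v => t.
rewrite /GRing.scale /GRing.mul /= !(pmulE, pscaleE); apply/term_classP.
exact: eqv_mulA.
Qed.
HB.instance Definition _ := GRing.Lmodule_isLalgebra.Build k presented pscaleAl.
HB.instance Definition _ := GRing.Lalgebra_isComAlgebra.Build k presented.

Definition pgen (x : X) : presented := term_class (Gen x).

Lemma eval_pgen t : eval pgen t = term_class t.
Proof.
elim: t => //= [c|s -> t ->|s -> t ->]; last exact: pmulE.
  rewrite /GRing.scale /= pscaleE; apply/term_classP.
  by apply: eqv_trans (eqv_mulC _ _) _; apply: eqv_mul1.
exact: paddE.
Qed.

Lemma presentedP (c : presented) : exists t, c = eval pgen t.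
Proof. by elim/term_classW: c => t; exists t; rewrite eval_pgen. Qed.

Lemma pgen_relation s t : relation s t -> eval pgen s = eval pgen t.
Proof. by move=> r; rewrite !eval_pgen; apply/term_classP/eqv_rel. Qed.

Lemma presented_lift (R : comAlgType k) (f : X -> R) :
  (forall s t, relation s t -> eval f s = eval f t) ->
  exists g : {lrmorphism presented -> R}, forall x, g (pgen x) = f x.
Proof.
move=> /eval_eqv fP; pose g (c : presented) := eval f (term_rep c).
have gE t : g (term_class t) = eval f t by apply/fP/eqv_term_rep.
have g_lin : is_linear g.
  move=> a; do 2!elim/term_classW=> ?.
  rewrite /GRing.scale /GRing.add /= pscaleE paddE !gE /=.
  by rewrite -scalerAl mul1r.
have g1 : g 1 = 1 by rewrite [g 1]gE /= scale1r.
have gM : {morph g : c d / c * d}.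
  by do 2!elim/term_classW=> ?; rewrite /GRing.mul /= pmulE !gE.
by exists (mk_lrmorphism g_lin g1 gM) => x; apply: gE.
Qed.

Lemma presented_hom_eq (R : comAlgType k) (f g : {lrmorphism presented -> R}) :
  (forall x, f (pgen x) = g (pgen x)) -> f = g.
Proof.
move=> fg; apply: lrmorphism_ext => c; have [t ->] := presentedP c.
elim: t => //= [c'|s IHs t IHt|s IHs t IHt]; rewrite ?(rmorphD, rmorphM, linearZ, rmorph1) //=.
- by rewrite IHs IHt.
- by rewrite IHs IHt.
Qed.

End PresentedAlgebra.

(** * Tensor products *)

Section LinearMaps.
Variables (k : fieldType) (V W : lmodType k) (x : V -> W) (x_lin : is_linear x).

Lemma lin0 : x 0 = 0.
Proof. by have := x_lin (-1) 0 0; rewrite scaler0 addr0 scaleN1r addNr. Qed.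

Lemma linD a b : x (a + b) = x a + x b.
Proof. by have := x_lin 1 a b; rewrite !scale1r. Qed.

Lemma linZ c a : x (c *: a) = c *: x a.
Proof. by have := x_lin c a 0; rewrite !addr0 lin0 addr0. Qed.

Lemma linB a b : x (a - b) = x a - x b.
Proof. by rewrite linD -scaleN1r linZ scaleN1r. Qed.
End LinearMaps.

Section AlgebraRelations.
Variables (k : fieldType) (A : comAlgType k) (X : Type) (i : A -> X).

Inductive algebra_relation : term k X -> term k X -> Prop :=
| alg_rel_lin c a b : algebra_relation (Gen (i (c *: a + b)))
    (Add (Mul (Cst c) (Gen (i a))) (Gen (i b)))
| alg_rel_mul a b : algebra_relation (Gen (i (a * b))) (Mul (Gen (i a)) (Gen (i b)))
| alg_rel_one : algebra_relation (Gen (i 1)) (Cst 1).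

Lemma eval_algebra_relation (R : comAlgType k) (f : X -> R) (h : {lrmorphism A -> R}) :
  (forall a, f (i a) = h a) ->
  forall s t, algebra_relation s t -> eval f s = eval f t.
Proof.
move=> fi s t [c a b|a b|] /=; rewrite !fi.
- by rewrite linearP -scalerAl mul1r.
- by rewrite rmorphM.
- by rewrite rmorph1 scale1r.
Qed.

End AlgebraRelations.

Lemma pgen_hom (k : fieldType) (P : presentation k) (A : comAlgType k)
    (i : A -> generator P) :
  (forall s t, algebra_relation i s t -> relation s t) ->
  {h : {lrmorphism A -> presented P} | forall a, h a = pgen (i a)}.
Proof.
move=> iP; have h_lin : is_linear (fun a => pgen (i a)).
  move=> c a b; rewrite -[LHS]/(eval _ (Gen _)) (pgen_relation (iP _ _ (alg_rel_lin i c a b))).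
  by rewrite /= -scalerAl mul1r.
have h1 : pgen (i 1) = 1.
  by rewrite -[LHS]/(eval _ (Gen _)) (pgen_relation (iP _ _ (alg_rel_one i))) /= scale1r.
have hM : {morph (fun a => pgen (i a)) : a b / a * b}.
  by move=> a b; rewrite /= -[LHS]/(eval _ (Gen _)) (pgen_relation (iP _ _ (alg_rel_mul i a b))).
by exists (mk_lrmorphism h_lin h1 hM).
Qed.

Section Tensor.
Variables (k : fieldType) (A B : comAlgType k) (w : {lrmorphism A -> B}).

Definition tensor_relation s t :=
  algebra_relation (@inl A B) s t \/ algebra_relation (@inr A B) s t.

Definition tensor_gen (x : A + B) : B := match x with inl a => w a | inr b => b end.

Fact tensor_model (s t : term k (A + B)) :
  tensor_relation s t -> eval tensor_gen s = eval tensor_gen t.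
Proof.
case; first exact: (@eval_algebra_relation _ _ _ _ _ _ w).
exact: (@eval_algebra_relation _ _ _ _ _ _ idfun).
Qed.

(* The morphism w only serves to guarantee that the tensor product over k is
   nonzero. *)
Definition tensor : comAlgType k := presented (Presentation tensor_model).

Definition tinl : {lrmorphism A -> tensor} :=
  sval (@pgen_hom _ (Presentation tensor_model) A inl (fun s t => @or_introl _ _)).
Definition tinr : {lrmorphism B -> tensor} :=
  sval (@pgen_hom _ (Presentation tensor_model) B inr (fun s t => @or_intror _ _)).

Lemma tinlE a : tinl a = pgen (P := Presentation tensor_model) (inl a).
Proof. exact: (svalP (@pgen_hom _ (Presentation tensor_model) A inl _)). Qed.
Lemma tinrE b : tinr b = pgen (P := Presentation tensor_model) (inr b).
Proof. exact: (svalP (@pgen_hom _ (Presentation tensor_model) B inr _)). Qed.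

Lemma tensor_lift (R : comAlgType k) (f : {lrmorphism A -> R}) (g : {lrmorphism B -> R}) :
  exists h : {lrmorphism tensor -> R},
    (forall a, h (tinl a) = f a) /\ (forall b, h (tinr b) = g b).
Proof.
pose u (x : A + B) : R := match x with inl a => f a | inr b => g b end.
have [|h hP] := @presented_lift _ (Presentation tensor_model) R u.
  move=> s t [] /=; first exact: (@eval_algebra_relation _ _ _ _ _ _ f).
  exact: (@eval_algebra_relation _ _ _ _ _ _ g).
by exists h; split=> [a|b]; rewrite (tinlE, tinrE) hP.
Qed.

(** Finite sums of pure tensors with factors in [U] and [V]. For subspaces [U] and [V] this is the
    image of their tensor product. *)
Inductive tens (U : A -> Prop) (V : B -> Prop) : tensor -> Prop :=
| tens0 : tens U V 0
| tensS a b z : U a -> V b -> tens U V z -> tens U V (tinl a * tinr b + z).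

Lemma tens_add U V y z : tens U V y -> tens U V z -> tens U V (y + z).
Proof.
elim=> [|a b y' Ua Vb _ IH] zP; first by rewrite add0r.
by rewrite -addrA; apply: tensS => //; apply: IH.
Qed.

Lemma tens1 U V a b : U a -> V b -> tens U V (tinl a * tinr b).
Proof. by move=> Ua Vb; rewrite -[_ * _]addr0; apply: tensS => //; apply: tens0. Qed.

Lemma tensW (U U' : A -> Prop) (V V' : B -> Prop) z :
  (forall a, U a -> U' a) -> (forall b, V b -> V' b) -> tens U V z -> tens U' V' z.
Proof.
move=> UU VV; elim=> [|a b y Ua Vb _ IH]; first exact: tens0.
by apply: tensS; [apply: UU|apply: VV|].
Qed.

Lemma tens_mul (U : A -> Prop) (V : B -> Prop) y z :
  (forall a b, U a -> U b -> U (a * b)) -> (forall a b, V a -> V b -> V (a * b)) ->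
  tens U V y -> tens U V z -> tens U V (y * z).
Proof.
move=> UM VM; elim=> [|a b y' Ua Vb _ IH] zP; first by rewrite mul0r; apply: tens0.
rewrite mulrDl; apply: tens_add; last exact: IH.
elim: {IH} zP => [|a' b' z' Ua' Vb' _ IH']; first by rewrite mulr0; apply: tens0.
rewrite mulrDr; apply: tens_add => //.
by rewrite mulrACA -!rmorphM; apply: tens1; [apply: UM|apply: VM].
Qed.

Lemma tens_full z : tens (fun=> True) (fun=> True) z.
Proof.
have [t ->] := presentedP z; elim: t => [[a|b]|c|s Ps t Pt|s Ps t Pt] /=.
- by rewrite -tinlE -[tinl a]mulr1 -(rmorph1 tinr); apply: tens1.
- by rewrite -tinrE -[tinr b]mul1r -(rmorph1 tinl); apply: tens1.
- rewrite -[1]mulr1 -{1}(rmorph1 tinl) -(rmorph1 tinr) scalerAl -linearZ.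
  exact: tens1.
- exact: tens_add.
- exact: tens_mul.
Qed.

Section Bilinear.
Variables (W : lmodType k).
Implicit Type beta : A -> B -> W.

Definition bilinear_form beta :=
  (forall b, is_linear (beta^~ b)) /\ (forall a, is_linear (beta a)).

(* A and B act on bilinear forms by multiplication in either variable; the
   tensor product acts through sums of compositions of these operators. *)
Fixpoint act (t : term k (A + B)) beta : A -> B -> W :=
  match t with
  | Gen (inl a) => fun a' b' => beta (a * a') b'
  | Gen (inr b) => fun a' b' => beta a' (b * b')
  | Cst c => fun a' b' => c *: beta a' b'
  | Add s t => fun a' b' => act s beta a' b' + act t beta a' b'
  | Mul s t => act s (act t beta)
  end.

Lemma act_bilinear t beta : bilinear_form beta -> bilinear_form (act t beta).
Proof.
elim: t beta => [[a|b]|c|s IHs t IHt|s IHs t IHt] beta bil /=; last exact/IHs/IHt.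
- case: bil => l r; split=> [b|a'] c u v /=; last exact: r.
  by rewrite mulrDr -scalerAr l.
- case: bil => l r; split=> [b'|a'] c u v /=; first exact: l.
  by rewrite mulrDr -scalerAr r.
- case: bil => l r; split=> [b'|a'] d u v /=.
    by rewrite l scalerDr !scalerA mulrC.
  by rewrite r scalerDr !scalerA mulrC.
- case: (IHs _ bil) (IHt _ bil) => ls rs [lt rt].
  by split=> [b'|a'] d u v /=; rewrite (ls, rs) (lt, rt) addrACA scalerDr.
Qed.

Lemma act_add t beta beta' :
  act t (fun a b => beta a b + beta' a b) = fun a b => act t beta a b + act t beta' a b.
Proof.
elim: t beta beta' => [[a|b]|c|s IHs t IHt|s IHs t IHt] beta beta' //=.
- by apply/funext => a; apply/funext => b; rewrite scalerDr.
- by rewrite IHs IHt; apply/funext => a; apply/funext => b; rewrite addrACA.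
- by rewrite IHt IHs.
Qed.

Lemma act_scale t c beta :
  act t (fun a b => c *: beta a b) = fun a b => c *: act t beta a b.
Proof.
elim: t beta => [[a|b]|d|s IHs t IHt|s IHs t IHt] beta //=.
- by apply/funext => a; apply/funext => b; rewrite !scalerA mulrC.
- by rewrite IHs IHt; apply/funext => a; apply/funext => b; rewrite scalerDr.
- by rewrite IHt IHs.
Qed.

Lemma act_comm s t beta : act s (act t beta) = act t (act s beta).
Proof.
elim: s t beta => [x|c|s IHs s' IHs'|s IHs s' IHs'] t beta /=.
- elim: t beta => [y|c|s IHs t IHt|s IHs t IHt] beta /=.
  + by case: x y => x [] y; apply/funext => a; apply/funext => b //=; rewrite mulrCA.
  + by case: x.
  + by case: x IHs IHt => x /= IHs IHt; rewrite -IHs -IHt.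
  + by rewrite -IHt -IHs.
- by rewrite act_scale.
- by rewrite act_add -IHs -IHs'.
- by rewrite IHs' IHs.
Qed.

Lemma act_eqv s t : eqv (P := Presentation tensor_model) s t ->
  forall beta, bilinear_form beta -> act s beta = act t beta.
Proof.
elim=> {s t} /=.
- move=> s t st beta [l r]; apply/funext => a; apply/funext => b.
  case: st => [] [c u v|u v|] /=.
  + by rewrite mulrDl -scalerAl l.
  + by rewrite -mulrA mulrCA.
  + by rewrite mul1r scale1r.
  + by rewrite mulrDl -scalerAl r.
  + by rewrite -mulrA mulrCA.
  + by rewrite mul1r scale1r.
- by [].
- by move=> s t _ IH beta bil; rewrite IH.
- by move=> s t u _ IH _ IH' beta bil; rewrite IH ?IH'.
- by move=> s s' t t' _ IH _ IH' beta bil; rewrite IH ?IH'.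
- by move=> s s' t t' _ IH _ IH' beta bil; rewrite IH' // IH //; apply: act_bilinear.
- by move=> s t u beta _; apply/funext => a; apply/funext => b; rewrite addrA.
- by move=> s t beta _; apply/funext => a; apply/funext => b; rewrite addrC.
- by move=> s beta _; apply/funext => a; apply/funext => b; rewrite scale0r add0r.
- by [].
- by move=> s t beta _; rewrite act_comm.
- by move=> s beta _; apply/funext => a; apply/funext => b; rewrite scale1r.
- by move=> s beta _; apply/funext => a; apply/funext => b; rewrite !scale0r.
- by [].
- by move=> c d beta _; apply/funext => a; apply/funext => b; rewrite scalerDl.
- by move=> c d beta _; apply/funext => a; apply/funext => b; rewrite scalerA.
Qed.

(** The presentation directly gives only algebra morphisms out of the tensor product. Linear maps
    are obtained by letting [z] act on [beta] and evaluating the resulting form at [(1, 1)]. *)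
Lemma bilinear_lift beta : bilinear_form beta ->
  exists L : tensor -> W, is_linear L /\ forall a b, L (tinl a * tinr b) = beta a b.
Proof.
move=> bil; exists (fun z : presented (Presentation tensor_model) => act (term_rep z) beta 1 1); split.
  move=> c; do 2!elim/term_classW=> ?.
  rewrite /GRing.scale /GRing.add /= pscaleE paddE.
  by rewrite !(act_eqv (eqv_term_rep _) bil).
move=> a b; rewrite tinlE tinrE /pgen [_ * _]pmulE (act_eqv (eqv_term_rep _) bil) /=.
by rewrite !mulr1.
Qed.

End Bilinear.

Lemma tens_ind_linear (W : lmodType k) (L L' : tensor -> W) (U : A -> Prop) (V : B -> Prop) :
  is_linear L -> is_linear L' ->
  (forall a b, U a -> V b -> L (tinl a * tinr b) = L' (tinl a * tinr b)) ->
  forall z, tens U V z -> L z = L' z.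
Proof.
move=> Llin Llin' LL z; elim=> [|a b y Ua Vb _ IH]; first by rewrite !lin0.
by rewrite (linD Llin) (linD Llin') IH LL.
Qed.

Lemma tensor_functional (R : comAlgType k) (x : A -> R) (y : B -> R) :
  is_linear x -> is_linear y ->
  exists L : tensor -> R, is_linear L /\ forall a b, L (tinl a * tinr b) = x a * y b.
Proof.
move=> xl yl; apply: (@bilinear_lift R (fun a b => x a * y b)).
split=> [b|a] c u v /=; first by rewrite xl mulrDl scalerAl.
by rewrite yl mulrDr scalerAr.
Qed.

(** Serves for linear forms that are multiplicative only on a subalgebra, where [tensor_lift] does
    not apply. *)
Lemma tens_functional_mul (R : comAlgType k) (U : A -> Prop) (V : B -> Prop)
    (x : A -> R) (y : B -> R) (L : tensor -> R) :
  (forall a b, U a -> U b -> x (a * b) = x a * x b) ->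
  (forall a b, V a -> V b -> y (a * b) = y a * y b) ->
  is_linear L -> (forall a b, L (tinl a * tinr b) = x a * y b) ->
  forall z z', tens U V z -> tens U V z' -> L (z * z') = L z * L z'.
Proof.
move=> xM yM Llin LP z z'; elim=> [|a b {}z Ua Vb _ IH] z'P.
  by rewrite mul0r lin0 // mul0r.
rewrite mulrDl !(linD Llin) mulrDl IH //; congr (_ + _).
elim: {IH} z'P => [|a' b' {}z' Ua' Vb' _ IH']; first by rewrite mulr0 lin0 ?mulr0.
rewrite mulrDr !(linD Llin) mulrDr IH' mulrACA -!rmorphM !LP xM // yM //.
by rewrite mulrACA.
Qed.

End Tensor.

(** * Inverse limits of affine group schemes *)

Section GroupLaws.
Variables (k : fieldType) (G : affine_group_scheme k) (R : comAlgType k).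
Implicit Types x y z : points (group_coord G) R.

Lemma gmul_lcancel z x y : gmul z x = gmul z y -> x = y.
Proof. by move=> /(congr1 (gmul (ginv z))); rewrite !gmulA !gmulVg !gmul1g. Qed.

Lemma gmulg1 x : gmul x (gone G R) = x.
Proof.
apply: (@gmul_lcancel (ginv x)); rewrite gmulA !gmulVg.
exact: gmul1g.
Qed.

Lemma gmulgV x : gmul x (ginv x) = gone G R.
Proof. by apply: (@gmul_lcancel (ginv x)); rewrite gmulA gmulVg gmul1g gmulg1. Qed.

Lemma ginvM x y : ginv (gmul x y) = gmul (ginv y) (ginv x).
Proof.
apply: (@gmul_lcancel (gmul x y)); rewrite gmulgV gmulA -(gmulA x) gmulgV.
by rewrite gmulg1 gmulgV.
Qed.

Lemma ginvK x : ginv (ginv x) = x.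
Proof. by apply: (@gmul_lcancel (ginv x)); rewrite gmulgV gmulVg. Qed.
End GroupLaws.

Section GroupHom.
Variables (k : fieldType) (G H : affine_group_scheme k) (f : group_scheme_hom G H).
Variable (R : comAlgType k).

Lemma hom_gone : points_comap (comorph f) (gone G R) = gone H R.
Proof.
apply: (@gmul_lcancel _ _ _ (points_comap (comorph f) (gone G R))).
by rewrite -comorph_mul gmul1g gmulg1.
Qed.

Lemma hom_ginv (x : points (group_coord G) R) :
  points_comap (comorph f) (ginv x) = ginv (points_comap (comorph f) x).
Proof.
apply: (@gmul_lcancel _ _ _ (points_comap (comorph f) x)).
by rewrite -comorph_mul !gmulgV hom_gone.
Qed.
End GroupHom.

Section Colimit.
Variables (k : fieldType) (d : Order.disp_t) (I : porderType d).
Variables (S : inverse_system k I).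
Local Notation D i := (group_coord (component S i)).
Local Notation tr le := (comorph (transition S le)).

Definition colim_gen := {i : I & D i}.
Definition colim_in i (a : D i) : colim_gen := existT (fun i => D i : Type) i a.

Inductive colim_relation : term k colim_gen -> term k colim_gen -> Prop :=
| colim_alg i s t : algebra_relation (@colim_in i) s t -> colim_relation s t
| colim_trans i j (le_ij : (i <= j)%O) (a : D i) :
    colim_relation (Gen (colim_in a)) (Gen (colim_in (tr le_ij a))).

Section Cone.
Variables (R : comAlgType k) (f : forall i, {lrmorphism D i -> R}).
Hypothesis f_compat : forall i j (le_ij : (i <= j)%O) a, f j (tr le_ij a) = f i a.

Definition cone_val (x : colim_gen) : R := f (projT1 x) (projT2 x).

Lemma cone_relation s t : colim_relation s t -> eval cone_val s = eval cone_val t.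
Proof.
case=> [i {}s {}t|i j le_ij a] /=; last by rewrite /cone_val /= f_compat.
exact: (@eval_algebra_relation _ _ _ _ _ _ (f i)).
Qed.
End Cone.

(** The unit sections form a cone from the coordinate algebras to [k]; this is the model that makes
    the colimit nonzero. *)
Fact unit_compat i j (le_ij : (i <= j)%O) a :
  gone (component S j) k^o (tr le_ij a) = gone (component S i) k^o a.
Proof. by rewrite -(hom_gone (transition S le_ij)). Qed.

Definition colimit : comAlgType k := presented (Presentation (cone_relation unit_compat)).

Definition colim_inj i : {lrmorphism D i -> colimit} :=
  sval (@pgen_hom _ (Presentation (cone_relation unit_compat)) (D i) (@colim_in i)
    (fun s t => @colim_alg i s t)).

Lemma colim_injE i a :
  colim_inj i a = pgen (P := Presentation (cone_relation unit_compat)) (colim_in a).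
Proof. exact: (svalP (@pgen_hom _ (Presentation (cone_relation unit_compat)) _ _ _)). Qed.

Lemma colim_inj_compat i j (le_ij : (i <= j)%O) a :
  colim_inj j (tr le_ij a) = colim_inj i a.
Proof.
rewrite !colim_injE; symmetry.
exact: (pgen_relation (P := Presentation (cone_relation unit_compat)) (colim_trans le_ij a)).
Qed.

Lemma colimit_lift (R : comAlgType k) (f : forall i, {lrmorphism D i -> R}) :
  (forall i j (le_ij : (i <= j)%O) a, f j (tr le_ij a) = f i a) ->
  {h : {lrmorphism colimit -> R} | forall i, points_comap (colim_inj i) h = f i}.
Proof.
move=> f_compat; apply: cid.
have [|h hP] := @presented_lift _ (Presentation (cone_relation unit_compat)) R (cone_val f).
  by move=> s t; apply: cone_relation.
by exists h => i; apply: lrmorphism_ext => a; rewrite /= colim_injE hP.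
Qed.

Lemma colimit_ext (R : comAlgType k) (x y : points colimit R) :
  (forall i, points_comap (colim_inj i) x = points_comap (colim_inj i) y) -> x = y.
Proof.
move=> xy; apply: presented_hom_eq => -[i a]; rewrite -[existT _ _ _]/(colim_in a).
rewrite -(colim_injE a) -[LHS]/(points_comap (colim_inj i) x a) xy.
by rewrite /= colim_injE.
Qed.

Lemma colimit_point_compat (R : comAlgType k) (x : points colimit R) i j
    (le_ij : (i <= j)%O) :
  points_comap (tr le_ij) (points_comap (colim_inj j) x) = points_comap (colim_inj i) x.
Proof. by apply: lrmorphism_ext => a; rewrite /= colim_inj_compat. Qed.

Fact colim_mul_compat (R : comAlgType k) (x y : points colimit R) i j
    (le_ij : (i <= j)%O) a :
  gmul (points_comap (colim_inj j) x) (points_comap (colim_inj j) y) (tr le_ij a) =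
  gmul (points_comap (colim_inj i) x) (points_comap (colim_inj i) y) a.
Proof. by rewrite -!(colimit_point_compat _ le_ij) -comorph_mul. Qed.

Fact colim_one_compat (R : comAlgType k) i j (le_ij : (i <= j)%O) a :
  gone (component S j) R (tr le_ij a) = gone (component S i) R a.
Proof. by rewrite -(hom_gone (transition S le_ij)). Qed.

Fact colim_inv_compat (R : comAlgType k) (x : points colimit R) i j
    (le_ij : (i <= j)%O) a :
  ginv (points_comap (colim_inj j) x) (tr le_ij a) =
  ginv (points_comap (colim_inj i) x) a.
Proof. by rewrite -!(colimit_point_compat _ le_ij) -hom_ginv. Qed.

Definition colim_mul (R : comAlgType k) (x y : points colimit R) : points colimit R :=
  sval (colimit_lift (colim_mul_compat x y)).
Definition colim_one (R : comAlgType k) : points colimit R :=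
  sval (colimit_lift (@colim_one_compat R)).
Definition colim_inv (R : comAlgType k) (x : points colimit R) : points colimit R :=
  sval (colimit_lift (colim_inv_compat x)).

Lemma colim_mulE R x y i : points_comap (colim_inj i) (@colim_mul R x y) =
  gmul (points_comap (colim_inj i) x) (points_comap (colim_inj i) y).
Proof. exact: (svalP (colimit_lift (colim_mul_compat x y))). Qed.
Lemma colim_oneE R i : points_comap (colim_inj i) (colim_one R) = gone _ R.
Proof. exact: (svalP (colimit_lift (@colim_one_compat R))). Qed.
Lemma colim_invE R x i : points_comap (colim_inj i) (@colim_inv R x) =
  ginv (points_comap (colim_inj i) x).
Proof. exact: (svalP (colimit_lift (colim_inv_compat x))). Qed.

Lemma points_map_comap (A B R T : comAlgType k) (phi : {lrmorphism R -> T})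
    (f : {lrmorphism B -> A}) (x : points A R) :
  points_comap f (points_map phi x) = points_map phi (points_comap f x).
Proof. exact: lrmorphism_ext. Qed.

Fact colim_mul_natural (R T : comAlgType k) (phi : {lrmorphism R -> T})
    (x y : points colimit R) :
  points_map phi (colim_mul x y) = colim_mul (points_map phi x) (points_map phi y).
Proof.
apply: colimit_ext => i.
by rewrite points_map_comap !colim_mulE gmul_natural !points_map_comap.
Qed.
Fact colim_one_natural (R T : comAlgType k) (phi : {lrmorphism R -> T}) :
  points_map phi (colim_one R) = colim_one T.
Proof. by apply: colimit_ext => i; rewrite points_map_comap !colim_oneE gone_natural. Qed.
Fact colim_inv_natural (R T : comAlgType k) (phi : {lrmorphism R -> T})
    (x : points colimit R) :
  points_map phi (colim_inv x) = colim_inv (points_map phi x).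
Proof.
apply: colimit_ext => i.
by rewrite points_map_comap !colim_invE ginv_natural !points_map_comap.
Qed.
Fact colim_mulA R : associative (@colim_mul R).
Proof. by move=> x y z; apply: colimit_ext => i; rewrite !colim_mulE gmulA. Qed.
Fact colim_mul1 R : left_id (colim_one R) (@colim_mul R).
Proof. by move=> x; apply: colimit_ext => i; rewrite colim_mulE colim_oneE gmul1g. Qed.
Fact colim_mulV R : left_inverse (colim_one R) (@colim_inv R) (@colim_mul R).
Proof.
by move=> x; apply: colimit_ext => i; rewrite colim_mulE colim_invE colim_oneE gmulVg.
Qed.

Definition colimit_group : affine_group_scheme k :=
  AffineGroupScheme colim_mul_natural colim_one_natural colim_inv_natural
    colim_mulA colim_mul1 colim_mulV.

Definition colimit_proj i : group_scheme_hom colimit_group (component S i) :=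
  @GroupSchemeHom k colimit_group (component S i) (colim_inj i)
    (fun R x y => @colim_mulE R x y i).

Variables (G : affine_group_scheme k).
Variable pr : forall i : I, group_scheme_hom G (component S i).

(** The colimit of the coordinate algebras carries a group scheme structure, so the universal
    property gives [comorph u] from [k[G]] to it, while the projections [pr] give [e] in the other
    direction. By uniqueness [e \o comorph u] is the identity, hence [e] is surjective, and by
    directedness each element of the colimit comes from a single component. *)
Lemma limit_coord_union : directed_poset I -> is_inverse_limit pr ->
  forall a : group_coord G, exists i b, a = comorph (pr i) b.
Proof.
move=> [[i0] dir] [cone univ] a.
have [|u [uP _]] := univ colimit_group colimit_proj.
  by move=> i j le_ij b /=; rewrite colim_inj_compat.
have [|e eP] := @colimit_lift _ (fun i => comorph (pr i)).
  by move=> i j le_ij b; rewrite (cone i j le_ij).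
(* Uniqueness holds among group homomorphisms only, so [e] and then the composite must be shown to
   respect multiplication. *)
have e_mul (R : comAlgType k) (x y : points (group_coord G) R) :
    points_comap e (gmul x y) = colim_mul (points_comap e x) (points_comap e y).
  have E (z : points (group_coord G) R) i :
      points_comap (colim_inj i) (points_comap e z) = points_comap (comorph (pr i)) z.
    by rewrite -eP; apply: lrmorphism_ext.
  by apply: colimit_ext => i; rewrite colim_mulE !E comorph_mul.
have eu_mul (R : comAlgType k) (x y : points (group_coord G) R) :
    points_comap (e \o comorph u) (gmul x y) =
    gmul (points_comap (e \o comorph u) x) (points_comap (e \o comorph u) y).
  have E (z : points (group_coord G) R) :
      points_comap (e \o comorph u) z = points_comap (comorph u) (points_comap e z).
    exact: lrmorphism_ext.
  by rewrite !E e_mul (comorph_mul u).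
have [u0 [_ u0P]] := univ G pr cone.
have id_mul (R : comAlgType k) (x y : points (group_coord G) R) :
    points_comap idfun (gmul x y) = gmul (points_comap idfun x) (points_comap idfun y).
  have E (z : points (group_coord G) R) : points_comap idfun z = z.
    exact: lrmorphism_ext.
  by rewrite !E.
have E1 := u0P (GroupSchemeHom id_mul) (fun i b => erefl).
have E2 : e \o comorph u =1 comorph u0.
  apply: (u0P (GroupSchemeHom eu_mul)) => i b /=.
  by rewrite -[comorph u _](uP i b) -eP.
have aE : a = e (comorph u a) by rewrite -[RHS]/((e \o comorph u) a) E2 -E1.
suff [i [b E]] : exists i b, comorph u a = colim_inj i b.
  by exists i, b; rewrite aE E -eP.
have [t ->] := presentedP (comorph u a); elim: t => [[i b]|c|s IHs t IHt|s IHs t IHt] /=.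
- by exists i, b; rewrite colim_injE.
- by exists i0, c%:A; rewrite linearZ /= rmorph1.
- have [i [b ->]] := IHs; have [j [c ->]] := IHt; have [l [il jl]] := dir i j.
  by exists l, (tr il b + tr jl c); rewrite rmorphD /= !colim_inj_compat.
- have [i [b ->]] := IHs; have [j [c ->]] := IHt; have [l [il jl]] := dir i j.
  by exists l, (tr il b * tr jl c); rewrite rmorphM /= !colim_inj_compat.
Qed.

End Colimit.

(** * Lifting points along homomorphisms *)

Section ImageSubgroup.
Variables (k : fieldType).

(** On the image of [phi] the factorization is forced; a linear projection onto that image extends
    it to all of [W]. *)
Lemma linear_factor (V W U : lmodType k) (phi : V -> W) (x : V -> U) :
  is_linear phi -> is_linear x -> (forall v, phi v = 0 -> x v = 0) ->
  exists y : W -> U, is_linear y /\ forall v, y (phi v) = x v.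
Proof.
move=> phil xl ker; pose im w := exists v, w = phi v.
have im_sub : is_subspace im.
  split=> [|c _ _ [v ->] [v' ->]]; first by exists 0; rewrite lin0.
  by exists (c *: v + v'); rewrite phil.
have [pi [pil piU piE]] := subspace_projection im_sub.
have [s sP] := choice piU.
have xE v v' : phi v = phi v' -> x v = x v'.
  move=> E; apply/eqP; rewrite -subr_eq0 -linB // ker // linB //.
  by rewrite E subrr.
exists (x \o s); split=> [c a b|v] /=; last by apply: xE; rewrite -sP piE //; exists v.
by rewrite -xl; apply: xE; rewrite phil -!sP pil.
Qed.

(** These are the [R]-points of the scheme-theoretic image of the morphism with comorphism [phi]. *)
Definition kills_kernel (D A R : comAlgType k) (phi : {lrmorphism D -> A}) (x : points D R) :=
  forall a, phi a = 0 -> x a = 0.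

Variables (G H : affine_group_scheme k) (p : group_scheme_hom G H).
Local Notation phi := (comorph p).
Local Notation A := (group_coord G).
Local Notation D := (group_coord H).
Variable (R : comAlgType k).
Implicit Types x y : points (group_coord H) R.

(** The comultiplication [U] of [D] sends [n] to an element that dies in the tensor square of [A],
    because [p] is a homomorphism. Since [x] and [y] factor linearly through [phi], the morphism [e]
    given by [x] and [y] on the tensor square of [D] factors linearly through that of [A]. *)
Lemma kills_kernel_mul x y :
  kills_kernel phi x -> kills_kernel phi y -> kills_kernel phi (gmul x y).
Proof.
move=> xN yN n phin.
pose iA : {lrmorphism A -> A} := idfun; pose iD : {lrmorphism D -> D} := idfun.
pose U := gmul (tinl iD : points D _) (tinr iD).
have [h [hl hr]] := @tensor_lift _ _ _ iD _ (tinl iA \o phi) (tinr iA \o phi).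
have [e [el er]] := @tensor_lift _ _ _ iD _ x y.
have [x' [x'lin x'E]] := linear_factor (lrmorphism_linear phi) (lrmorphism_linear x) xN.
have [y' [y'lin y'E]] := linear_factor (lrmorphism_linear phi) (lrmorphism_linear y) yN.
have [L [Llin LE]] := @tensor_functional _ _ _ iA _ x' y' x'lin y'lin.
have hU : h (U n) = 0.
  have E : points_map h U = points_comap phi (gmul (tinl iA : points A _) (tinr iA)).
    rewrite gmul_natural comorph_mul.
    by congr (gmul _ _); apply: lrmorphism_ext => a; rewrite /= (hl, hr).
  by rewrite -[h (U n)]/(points_map h U n) E /= phin rmorph0.
have eU : gmul x y n = e (U n).
  have E : points_map e U = gmul x y.
    rewrite gmul_natural; congr (gmul _ _); apply: lrmorphism_ext => a /=.
      exact: el.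
    exact: er.
  by rewrite -E.
rewrite eU; have -> : e (U n) = L (h (U n)); last by rewrite hU lin0.
apply: (@tens_ind_linear _ _ _ iD _ _ (fun z => L (h z)) (fun=> True) (fun=> True)).
- exact: lrmorphism_linear.
- by move=> c a b; rewrite (lrmorphism_linear h) Llin.
- by move=> a b _ _; rewrite !rmorphM /= el er hl hr LE x'E y'E.
- exact: tens_full.
Qed.

Lemma kills_kernel_inv x : kills_kernel phi x -> kills_kernel phi (ginv x).
Proof.
move=> xN n phin; pose i : points (group_coord H) (group_coord H) := idfun.
have -> : ginv x n = x (ginv i n).
  have E : points_map x (ginv i) = ginv x.
    by rewrite ginv_natural; congr ginv; apply: lrmorphism_ext.
  by rewrite -E.
apply: xN; pose iA : points (group_coord G) (group_coord G) := idfun.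
have E : points_map phi (ginv i) = points_comap phi (ginv iA).
  by rewrite ginv_natural hom_ginv; congr ginv; apply: lrmorphism_ext.
by rewrite -[phi _]/(points_map phi (ginv i) n) E /= phin rmorph0.
Qed.

End ImageSubgroup.

(** * Finitely generated subalgebras *)

Section Generated.
Variables (k : fieldType) (D : comAlgType k).
Implicit Types (P : D -> Prop) (s : seq D).

Definition is_subalgebra P :=
  [/\ forall c, P c%:A, forall a b, P a -> P b -> P (a + b) &
      forall a b, P a -> P b -> P (a * b)].

Definition generated s a :=
  forall P, is_subalgebra P -> (forall b, b \in s -> P b) -> P a.

Lemma generated_subalgebra s : is_subalgebra (generated s).
Proof.
split=> [c P [PC _ _] _|a b ga gb P Psub Ps|a b ga gb P Psub Ps]; first exact: PC.
  by case: (Psub) => _ PD _; apply: PD; [apply: ga|apply: gb].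
by case: (Psub) => _ _ PM; apply: PM; [apply: ga|apply: gb].
Qed.

Lemma mem_generated s a : a \in s -> generated s a.
Proof. by move=> sa P _; apply. Qed.

Lemma generated_sub s s' a : {subset s <= s'} -> generated s a -> generated s' a.
Proof. by move=> ss ga P Psub Ps; apply: ga => // b /ss; apply: Ps. Qed.

Lemma subalgebra1 P : is_subalgebra P -> P 1.
Proof. by case=> + _ _ => /(_ 1); rewrite scale1r. Qed.

Lemma subalgebra_subspace P : is_subalgebra P -> is_subspace P.
Proof.
case=> PC PD PM; split; first by have := PC 0; rewrite scale0r.
by move=> c a b Pa Pb; apply: PD => //; rewrite -mulr_algl; apply: PM.
Qed.
End Generated.

Lemma of_finite_type_gen (k : fieldType) (G : affine_group_scheme k) :
  of_finite_type G -> exists s, forall a : group_coord G, generated s a.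
Proof.
move=> [n [f f_surj]]; exists [seq f (mpoly.mpolyX k (mpoly.mnm1 i)) | i : 'I_n].
move=> a P [PC PD PM] Ps; have [p <-] := f_surj a.
have PX m : P (f (mpoly.mpolyX k m)).
  rewrite mpoly.mpolyXE_id rmorph_prod; apply: big_ind => //.
    by rewrite -(scale1r 1); apply: PC.
  move=> i _; rewrite rmorphXn; elim: (mpoly.fun_of_multinom m i) => [|j IH].
    by rewrite expr0 -(scale1r 1); apply: PC.
  by rewrite exprS; apply: PM => //; apply: Ps; apply/mapP; exists i; rewrite ?mem_enum.
rewrite (mpoly.mpolyE p) rmorph_sum; apply: big_ind => //.
  by rewrite -(scale0r 1); apply: PC.
by move=> m _; rewrite /= linearZ /= -mulr_algl; apply: PM.
Qed.

(** * Irreducible components and their points *)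

Section Components.
Variables (k : closedFieldType).

(** A minimal prime over the kernel of [phi] is the contraction of a prime of [A]. Indeed [phi] maps
    [M] to a submonoid without 0, so some prime of [A] avoids it; and for [a] outside [M] some
    [m * a ^+ n] with [m] in [M] is killed by [phi], which forces [pi (phi a) = 0]. *)
Lemma max_submonoid_field (D A : comAlgType k) (phi : {lrmorphism D -> A}) M :
  is_max_submonoid (fun a => phi a = 0) M ->
  exists (K : fieldType) (pi : {rmorphism A -> K}), forall a, M a <-> pi (phi a) <> 0.
Proof.
move=> [[M1 MM] MN Mmax].
pose S b := exists2 a, M a & b = phi a.
have [||q [q_prime qS _]] := @max_ideal_avoiding A S.
- split; first by exists 1 => //; rewrite rmorph1.
  move=> _ _ [a Ma ->] [b Mb ->]; exists (a * b); rewrite ?rmorphM //.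
  exact: MM.
- by move=> [a /MN + E]; rewrite -E.
have [K [pi piq]] := residue_field q_prime; exists K, pi => a; split.
  by move=> Ma /piq /qS; apply; exists a.
move=> pa; apply: contrapT => /Mmax[m [n [Mm E]]].
have /eqP : pi (phi (m * a ^+ n)) = 0 by rewrite E rmorph0.
rewrite !rmorphM !rmorphXn /= mulf_eq0 expf_eq0 => /orP[/eqP/piq/qS|/andP[_ /eqP]] //.
by apply; exists m.
Qed.

Lemma point_of_hom (D : comAlgType k) (K : fieldType) (pi : {rmorphism D -> K})
    (iota : {rmorphism k -> K}) (C : K -> Prop) x :
  (forall c, pi c%:A = iota c) -> is_subalg iota C -> (forall a, C (pi a)) ->
  is_hom_on iota C x -> exists y : points D k^o, forall a, y a = x (pi a).
Proof.
move=> piC C_sub Cpi x_hom; pose y a : k^o := x (pi a).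
have xi c : x (iota c) = c by case: x_hom.
have y_lin : is_linear y.
  move=> c a b; rewrite /y rmorphD -mulr_algl rmorphM piC.
  have Ci : C (iota c) by case: C_sub.
  by rewrite (hom_onD C_sub x_hom) ?(hom_onM x_hom) ?xi //; apply: subalgM C_sub _ _ _ _.
have y1 : y 1 = 1 by rewrite /y rmorph1 (hom_on1 x_hom).
have yM : {morph y : a b / a * b}.
  by move=> a b; rewrite /y rmorphM (hom_onM x_hom).
by exists (mk_lrmorphism y_lin y1 yM).
Qed.

(* For M as in is_max_submonoid these are the points of an irreducible component. *)
Definition vanishes_off (D : comAlgType k) (M : D -> Prop) (x : points D k^o) :=
  forall a, ~ M a -> x a = 0.

Lemma generated_image (D : comAlgType k) (K : fieldType) (pi : {rmorphism D -> K})
    (iota : {rmorphism k -> K}) (C : K -> Prop) s :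
  (forall c, pi c%:A = iota c) -> is_subalg iota C -> (forall a, generated s a) ->
  (forall a, a \in s -> C (pi a)) -> forall a, C (pi a).
Proof.
move=> piC C_sub gen Cs a; apply: (gen a (fun a => C (pi a))) => //; split.
- by move=> c; rewrite piC; case: C_sub.
- by move=> b b' Cb Cb'; rewrite rmorphD; apply: subalgD C_sub _ _ _ _.
- by move=> b b' Cb Cb'; rewrite rmorphM; apply: subalgM C_sub _ _ _ _.
Qed.

Lemma component_point (D A : comAlgType k) (phi : {lrmorphism D -> A}) M s a :
  is_max_submonoid (fun a => phi a = 0) M -> (forall a : D, generated s a) -> M a ->
  exists x : points D k^o, vanishes_off M x /\ x a <> 0.
Proof.
move=> Mmax gen Ma; have [K [pi MP]] := max_submonoid_field Mmax.
pose iota : {rmorphism k -> K} := pi \o in_alg A.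
pose theta : {rmorphism D -> K} := pi \o phi.
have thetaC c : theta c%:A = iota c by rewrite /= linearZ /= rmorph1.
pose C := adjoin (scalars iota) (map theta s).
have C_sub : is_subalg iota C by apply/adjoin_subalg/scalars_subalg.
have Ctheta b : C (theta b).
  apply: (generated_image thetaC C_sub gen) => {}b bs.
  by apply: mem_adjoin; [apply: scalars_subalg|apply: map_f].
have /eqP a0 := (MP a).1 Ma.
have [x [x_hom xa]] := weak_nullstellensatz (Ctheta a) a0.
have [y yE] := point_of_hom thetaC C_sub Ctheta x_hom.
exists y; split=> [b nMb|]; last by rewrite yE; apply/eqP.
rewrite yE; have -> : theta b = 0 by apply: contrapT => /MP.
exact: hom_on0 x_hom.
Qed.

(** A point of the component [M] factors through the image [C] of [D] in [K], and the image of [D']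
    lies in a finitely generated extension [C'] of [C], to which [extend_adjoin] applies. The lifted
    point kills the kernel of [phi'] because it factors through [phi']. *)
Lemma component_lift (D D' A : comAlgType k) (phi : {lrmorphism D -> A})
    (phi' : {lrmorphism D' -> A}) (f : {lrmorphism D -> D'}) M s :
  phi =1 phi' \o f -> is_max_submonoid (fun a => phi a = 0) M ->
  (forall a : D', generated s a) ->
  exists a, M a /\ forall x : points D k^o, vanishes_off M x -> x a <> 0 ->
    exists x' : points D' k^o, kills_kernel phi' x' /\ points_comap f x' = x.
Proof.
move=> phiE Mmax gen; have [K [pi MP]] := max_submonoid_field Mmax.
pose iota : {rmorphism k -> K} := pi \o in_alg A.
pose theta : {rmorphism D -> K} := pi \o phi.
pose theta' : {rmorphism D' -> K} := pi \o phi'.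
have thetaC c : theta c%:A = iota c by rewrite /= linearZ /= rmorph1.
have thetaC' c : theta' c%:A = iota c by rewrite /= linearZ /= rmorph1.
have thetaE b : theta b = theta' (f b) by rewrite /= phiE.
pose C e := exists b, e = theta b.
have C_sub : is_subalg iota C.
  split=> [c|_ _ [b ->] [b' ->]|_ _ [b ->] [b' ->]].
  - by exists c%:A.
  - by exists (b - b'); rewrite rmorphB.
  - by exists (b * b'); rewrite rmorphM.
pose C' := adjoin C (map theta' s).
have C'_sub : is_subalg iota C' by apply/adjoin_subalg.
have Ctheta' b : C' (theta' b).
  apply: (generated_image thetaC' C'_sub gen) => {}b bs.
  by apply: mem_adjoin C_sub _; apply: map_f.
(* Taking [b = 1] asks for nothing beyond the existence of an extension. *)
have [e [[a ->] a0 aP]] := extend_adjoin C_sub (subalg1 C'_sub) (oner_neq0 K).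
exists a; split; first by apply/MP/eqP.
move=> x xM /eqP xa.
have xE b b' : theta b = theta b' -> x b = x b'.
  move=> E; apply/eqP; rewrite -subr_eq0 -rmorphB /= xM // => /MP.
  by apply; rewrite -[pi _]/(theta (b - b')) rmorphB E subrr.
have [xK xKE] : {xK : K -> k & forall b, xK (theta b) = x b}.
  have : forall e, exists c, forall b, e = theta b -> c = x b.
    move=> e'; have [[b ->]|ne] := pselect (C e').
      by exists (x b) => b' /xE.
    by exists 0 => b E; case: ne; exists b.
  by move=> /choice[xK xKP]; exists xK => b; apply: xKP.
have xK_hom : is_hom_on iota C xK.
  split=> [c|_ _ [b ->] [b' ->]|_ _ [b ->] [b' ->]].
  - by rewrite -thetaC xKE linearZ /= rmorph1 [_ *: _]mulr1.
  - by rewrite -rmorphB !xKE rmorphB.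
  - by rewrite -rmorphM !xKE rmorphM.
have [|x' [x'_hom x'E _]] := aP xK xK_hom; first by rewrite xKE.
have [y yE] := point_of_hom thetaC' C'_sub Ctheta' x'_hom.
exists y; split=> [b b0|]; first by rewrite yE /= b0 rmorph0 (hom_on0 x'_hom).
apply: lrmorphism_ext => b; rewrite /= yE -thetaE x'E ?xKE //.
by exists b.
Qed.

End Components.

Section LiftPoint.
Variables (k : closedFieldType) (G H H' : affine_group_scheme k).
Variables (p : group_scheme_hom G H) (p' : group_scheme_hom G H').
Variable (f : group_scheme_hom H' H).
Hypothesis pE : comorph p =1 comorph p' \o comorph f.
Hypotheses (H_ft : of_finite_type H) (H'_ft : of_finite_type H').
Local Notation D := (group_coord H).
Local Notation phi := (comorph p).

Fact scalar_inclusion_linear : @is_linear k k^o D (fun c => c%:A).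
Proof. by move=> c a b; rewrite scalerDl scalerA. Qed.
Fact scalar_inclusion_mul : {morph (fun c : k^o => c%:A : D) : a b / a * b}.
Proof. by move=> a b; rewrite -scalerAl mul1r scalerA. Qed.
Definition scalar_inclusion : {lrmorphism k^o -> D} :=
  mk_lrmorphism scalar_inclusion_linear (scale1r 1) scalar_inclusion_mul.

Lemma point_scalar (R : comAlgType k) (x : points D R) c :
  x (scalar_inclusion c) = c%:A.
Proof. by rewrite -[scalar_inclusion c]/(c%:A) linearZ /= rmorph1. Qed.

Lemma lift_point (g : points D k^o) : kills_kernel phi g ->
  exists g' : points (group_coord H') k^o,
    kills_kernel (comorph p') g' /\ points_comap (comorph f) g' = g.
Proof.
move=> gN; have [s gen] := of_finite_type_gen H_ft.
have [s' gen'] := of_finite_type_gen H'_ft.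
(* [gD] is [g] viewed as a constant [D]-point, and [idD] is the universal point. *)
pose gD : points D D := points_map scalar_inclusion g.
pose idD : points D D := idfun.
have gDE (R : comAlgType k) (x y : points D R) : points_map x gD = points_map y gD.
  by apply: lrmorphism_ext => a; rewrite /= !point_scalar.
have gDk (x : points D k^o) : points_map x gD = g.
  by apply: lrmorphism_ext => a; rewrite /= point_scalar [_ *: _]mulr1.
have idE (R : comAlgType k) (x : points D R) : points_map x idD = x by apply: lrmorphism_ext.
have gDid : points_map idD gD = gD by apply: lrmorphism_ext.
(* tau is the comorphism of x |-> g x^-1 and sigma that of x |-> x^-1 g. *)
pose tau := gmul gD (ginv idD); pose sigma := gmul (ginv idD) gD.
have tauE (R : comAlgType k) (x : points D R) :
    points_map x tau = gmul (points_map x gD) (ginv x).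
  by rewrite gmul_natural ginv_natural idE.
have sigmaE (R : comAlgType k) (x : points D R) :
    points_map x sigma = gmul (ginv x) (points_map x gD).
  by rewrite gmul_natural ginv_natural idE.
have tauK a : tau (sigma a) = a.
  have : points_map tau sigma = idD.
    rewrite sigmaE (gDE _ _ idD) gDid ginvM ginvK -gmulA.
    by rewrite gmulVg gmulg1.
  by move=> /(congr1 (fun h : points D D => h a)).
have sigmaK a : sigma (tau a) = a.
  have : points_map sigma tau = idD.
    rewrite tauE (gDE _ _ idD) gDid ginvM ginvK gmulA.
    by rewrite gmulgV gmul1g.
  by move=> /(congr1 (fun h : points D D => h a)).
have phi_gD : kills_kernel phi (points_map phi gD).
  by move=> a /gN a0; rewrite /= a0 point_scalar scale0r.
have phi_id : kills_kernel phi (phi : points D _) by [].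
(* As [g] lies in the image subgroup, the map from [x] to [g x^-1] preserves that subgroup. *)
have tauN a : phi a = 0 -> phi (tau a) = 0.
  rewrite -[phi (tau a)]/(points_map phi tau a) tauE.
  by apply: kills_kernel_mul => //; apply: kills_kernel_inv.
have sigmaN a : phi a = 0 -> phi (sigma a) = 0.
  rewrite -[phi (sigma a)]/(points_map phi sigma a) sigmaE.
  by apply: kills_kernel_mul => //; apply: kills_kernel_inv.
have [|M Mmax] := @max_submonoid_exists D (fun a => phi a = 0).
  by rewrite rmorph1; apply/eqP/oner_neq0.
(* [M'] is the component onto which the map from [x] to [g x^-1] carries the component [M]. *)
pose M' a := M (tau a).
have M'max : is_max_submonoid (fun a => phi a = 0) M'.
  case: Mmax => [[M1 MM] MN MP]; split.
  - split; first by rewrite /M' rmorph1.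
    by move=> a b; rewrite /M' rmorphM; apply: MM.
  - by move=> a /MN + /tauN.
  - move=> a /MP[m [n [Mm E]]]; exists (sigma m), n; split; first by rewrite /M' tauK.
    have -> : sigma m * a ^+ n = sigma (m * tau a ^+ n).
      by rewrite rmorphM rmorphXn /= sigmaK.
    exact: sigmaN.
have [a [Ma aP]] := component_lift pE Mmax gen'.
have [b [Mb bP]] := component_lift pE M'max gen'.
(* Irreducibility of the component: a single [x] satisfies both open conditions, so [x] and [g x^-1]
   lift simultaneously. *)
have Mab : M (a * tau b) by case: Mmax => -[_ MM] _ _; apply: MM.
have [x [xM xab]] := component_point Mmax gen Mab.
have [|x' [x'N x'E]] := aP x xM.
  by move=> xa; apply: xab; rewrite rmorphM /= xa mul0r.
have [||y' [y'N y'E]] := bP (points_map x tau).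
- by move=> c; apply: xM.
- by rewrite /= => xb; apply: xab; rewrite rmorphM /= xb mulr0.
exists (gmul y' x'); split; first exact: kills_kernel_mul.
by rewrite comorph_mul x'E y'E tauE gDk -gmulA gmulVg gmulg1.
Qed.

End LiftPoint.

(** * Torsors *)

Section TensorSubalgebras.
Variables (k : fieldType) (A B : comAlgType k) (w : {lrmorphism A -> B}).

Lemma tens_subalgebra (U : A -> Prop) (V : B -> Prop) :
  is_subalgebra U -> is_subalgebra V -> is_subalgebra (@tens _ _ _ w U V).
Proof.
move=> Usub Vsub; have [_ UZ] := subalgebra_subspace Usub.
case: (Usub) (Vsub) => UC UD UM [VC VD VM]; split; last 1 first.
- by move=> a b; apply: tens_mul.
- move=> c; rewrite -[1]mulr1 -{1}(rmorph1 (tinl w)) -(rmorph1 (tinr w)) scalerAl -linearZ.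
  by apply: tens1 => //; apply: subalgebra1.
- by move=> a b; apply: tens_add.
Qed.

Lemma tens_finite z : exists s s', @tens _ _ _ w (generated s) (generated s') z.
Proof.
elim: (tens_full z) => [|a b y _ _ _ [s [s' ss']]]; first by exists [::], [::]; apply: tens0.
exists (a :: s), (b :: s'); apply: tensS.
- by apply: mem_generated; rewrite mem_head.
- by apply: mem_generated; rewrite mem_head.
- by apply: tensW ss' => c; apply: generated_sub => x xs; rewrite inE xs orbT.
Qed.

Lemma tens_finite_hom (D : comAlgType k) (f : {lrmorphism D -> tensor w}) s0 :
  exists s s', forall d, generated s0 d -> tens (generated s) (generated s') (f d).
Proof.
suff [s [s' ss']] : exists s s', forall d, d \in s0 ->
    tens (generated s) (generated s') (f d).
  have [TC TD TM] := tens_subalgebra (generated_subalgebra s) (generated_subalgebra s').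
  exists s, s' => d gd; apply: (gd (fun d => tens _ _ (f d))) => //; split.
  - by move=> c; rewrite linearZ rmorph1; apply: TC.
  - by move=> a b; rewrite rmorphD; apply: TD.
  - by move=> a b; rewrite rmorphM; apply: TM.
elim: s0 => [|d s0 [s [s' IH]]]; first by exists [::], [::].
have [t [t' tt']] := tens_finite (f d).
exists (t ++ s), (t' ++ s') => e; rewrite inE => /orP[/eqP->|/IH].
  by apply: tensW tt' => c; apply: generated_sub => x xs; rewrite mem_cat xs.
by apply: tensW => c; apply: generated_sub => x xs; rewrite mem_cat xs orbT.
Qed.

Lemma scalar_functional : exists y : B -> k^o, is_linear y /\ y 1 = 1.
Proof.
pose f (c : k^o) : B := c%:A.
have f_lin : is_linear f by move=> c a b; rewrite /f scalerDl scalerA.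
have [||y [y_lin yE]] := @linear_factor k k^o B k^o f idfun f_lin.
- by [].
- by move=> c /eqP; rewrite scaler_eq0 oner_eq0 orbF => /eqP.
by exists y; split=> //; rewrite -[1](scale1r (1 : B)) -[_ *: _]/(f 1) yE.
Qed.

(** The bilinear form [beta] induces a map that vanishes on tensors with left factor in [U] and
    sends [tinl w a] to [a - pi a]. *)
Lemma tens_retract (U : A -> Prop) a :
  is_subspace U -> tens U (fun=> True) (tinl w a) -> U a.
Proof.
move=> Usub Ua; have [pi [pi_lin piU piE]] := subspace_projection Usub.
have [y [y_lin y1]] := scalar_functional.
pose beta a b := (y b : k) *: (a - pi a).
have [|L [L_lin LE]] := @bilinear_lift _ _ _ w A beta.
  split=> [b|a'] c u v; rewrite /beta.
    by rewrite pi_lin opprD addrACA -scalerBr scalerDr !scalerA mulrC.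
  by rewrite y_lin scalerDl -scalerA.
have : L (tinl w a) = 0.
  apply: (@tens_ind_linear _ _ _ w _ L (fun=> 0) U (fun=> True)) => //.
    by move=> c u v; rewrite scaler0 addr0.
  by move=> u v Uu _; rewrite LE /beta piE // subrr scaler0.
rewrite -[tinl w a]mulr1 -(rmorph1 (tinr w)) LE /beta y1 scale1r.
by move/eqP; rewrite subr_eq0 => /eqP ->.
Qed.
End TensorSubalgebras.

(** [rho] is the action on the universal pair, and [delta] is the group component of the preimage
    under the shear map of the two universal points of [P]. [h] is the comorphism of the map from
    [(p, q)] to [(delta(p, q), q)], so the last clause is the identity [delta(p, q) q = p]. *)
Lemma torsor_coaction (k : fieldType) (G : affine_group_scheme k) (P : torsor G) :
  let w := gone G (torsor_coord P) in
  let i : {lrmorphism torsor_coord P -> torsor_coord P} := idfun in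
  exists (rho : {lrmorphism torsor_coord P -> tensor w})
    (delta : {lrmorphism group_coord G -> tensor i})
    (h : {lrmorphism tensor w -> tensor i}),
  [/\ forall a, h (tinl w a) = delta a, forall b, h (tinr w b) = tinr i b &
      forall b, h (rho b) = tinl i b].
Proof.
move=> w i; pose rho := tact (tinl w : points _ _) (tinr w : points (torsor_coord P) _).
have [f _ fK] := tact_shear P (tensor i).
case E : (f (tinl i, tinr i)) => [delta p].
have := fK (tinl i, tinr i); rewrite E /= => -[deltaE pE].
have [h [hl hr]] := @tensor_lift _ _ _ w _ delta (tinr i).
exists rho, delta, h; split=> // b.
have : points_map h rho = tinl i.
  rewrite tact_natural -deltaE pE.
  by congr (tact _ _); apply: lrmorphism_ext.
by move=> /(congr1 (fun g : points _ _ => g b)).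
Qed.

Section TorsorPoints.
Variables (k : closedFieldType) (d : Order.disp_t) (I : porderType d).
Variables (S : inverse_system k I) (G : affine_group_scheme k).
Variable pr : forall i : I, group_scheme_hom G (component S i).
Hypothesis I_directed : directed_poset I.
Hypothesis S_ft : forall i : I, of_finite_type (component S i).
Hypothesis G_limit : is_inverse_limit pr.
Variable P : torsor G.
Local Notation A := (group_coord G).
Local Notation B := (torsor_coord P).
Local Notation phi i := (comorph (pr i)).

Definition proj_image i (a : A) := exists b, a = phi i b.

Lemma proj_image_subalgebra i : is_subalgebra (proj_image i).
Proof.
split=> [c|_ _ [a ->] [b ->]|_ _ [a ->] [b ->]].
- by exists c%:A; rewrite linearZ /= rmorph1.
- by exists (a + b); rewrite rmorphD.
- by exists (a * b); rewrite rmorphM.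
Qed.

Lemma proj_image_mono i j a : (i <= j)%O -> proj_image i a -> proj_image j a.
Proof.
by move=> le_ij [b ->]; exists (comorph (transition S le_ij) b); rewrite (G_limit.1 i j le_ij).
Qed.

Lemma tens_proj_image (w : {lrmorphism A -> B}) z :
  exists i s, @tens _ _ _ w (proj_image i) (generated s) z.
Proof.
elim: (tens_full z) => [|a b y _ _ _ [i [s ys]]].
  by have [[i] _] := I_directed; exists i, [::]; apply: tens0.
have [j [c ac]] := limit_coord_union I_directed G_limit a.
have [l [il jl]] := I_directed.2 i j.
exists l, (b :: s); apply: tensS.
- by apply: (proj_image_mono jl); exists c.
- by apply: mem_generated; rewrite mem_head.
apply: tensW ys => u; first exact: proj_image_mono.
by apply: generated_sub => x xs; rewrite inE xs orbT.
Qed.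

Lemma tens_proj_image_hom (w : {lrmorphism A -> B}) (f : {lrmorphism B -> tensor w}) s0 i0 :
  exists i s, (i0 <= i)%O /\
    forall b, generated s0 b -> tens (proj_image i) (generated s) (f b).
Proof.
suff [i [s [i0i ss]]] : exists i s, (i0 <= i)%O /\ forall b, b \in s0 ->
    tens (proj_image i) (generated s) (f b).
  have [TC TD TM] := tens_subalgebra w (proj_image_subalgebra i) (generated_subalgebra s).
  exists i, s; split=> // b gb; apply: (gb (fun b => tens _ _ (f b))) => //; split.
  - by move=> c; rewrite linearZ rmorph1; apply: TC.
  - by move=> a a'; rewrite rmorphD; apply: TD.
  - by move=> a a'; rewrite rmorphM; apply: TM.
elim: s0 => [|b s0 [i [s [i0i IH]]]]; first by exists i0, [::].
have [j [t tt]] := tens_proj_image (f b).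
have [l [il jl]] := I_directed.2 i j.
exists l, (t ++ s); split=> [|e]; first exact: Order.POrderTheory.le_trans il.
rewrite inE => /orP[/eqP->|/IH].
  apply: tensW tt => c; first exact: proj_image_mono.
  by apply: generated_sub => x xs; rewrite mem_cat xs.
apply: tensW => c; first exact: proj_image_mono.
by apply: generated_sub => x xs; rewrite mem_cat xs orbT.
Qed.

(* A k-point of the subalgebra generated by s, extended to a linear form. *)
Definition partial_point (s : seq B) (v : B -> k^o) :=
  [/\ is_linear v, v 1 = 1 &
      forall a b, generated s a -> generated s b -> v (a * b) = v a * v b].

Lemma partial_point_sub s s' v :
  {subset s <= s'} -> partial_point s' v -> partial_point s v.
Proof.
by move=> ss [vl v1 vM]; split=> // a b ga gb; apply: vM; apply: generated_sub ss _.
Qed.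

(** The Nullstellensatz is applied to the image of [generated s] in a residue field of [B]; a linear
    projection onto [generated s] then extends the point to a linear form on [B]. *)
Lemma partial_point_exists s : exists v, partial_point s v.
Proof.
have [||q [q_prime _ _]] := @max_ideal_avoiding B (fun a => a = 1).
- by split=> // a b -> ->; rewrite mulr1.
- by move/esym/eqP; rewrite oner_eq0.
have [K [pi _]] := residue_field q_prime.
pose iota : {rmorphism k -> K} := pi \o in_alg B.
pose C := adjoin (scalars iota) (map pi s).
have C_sub : is_subalg iota C by apply/adjoin_subalg/scalars_subalg.
have Cpi b : generated s b -> C (pi b).
  move=> gb; apply: (gb (fun b => C (pi b))) => [|{gb}b bs].
    split=> [c|a a'|a a']; rewrite ?rmorphD ?rmorphM.
    - by case: C_sub => + _ _; apply.
    - exact: (subalgD C_sub).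
    - exact: (subalgM C_sub).
  by apply: mem_adjoin; [apply: scalars_subalg|apply: map_f].
have [x [x_hom _]] := weak_nullstellensatz (subalg1 C_sub) (oner_neq0 K).
have s_sub := generated_subalgebra s.
have [sc sD sM] := s_sub.
have [f [fl fs fE]] := subspace_projection (subalgebra_subspace s_sub).
exists (fun b => x (pi (f b))); split.
- have Cf b : C (pi (f b)) by apply: Cpi.
  move=> c a b; rewrite fl rmorphD -mulr_algl rmorphM -[pi c%:A]/(iota c).
  have [Ci _ _] := C_sub; have [Cc Ca Cb] := And3 (Ci c) (Cf a) (Cf b).
  rewrite (hom_onD C_sub x_hom (subalgM C_sub Cc Ca) Cb) (hom_onM x_hom Cc Ca).
  by case: x_hom => ->.
- have -> : f 1 = 1 by apply: fE; apply: subalgebra1.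
  by rewrite rmorph1 (hom_on1 x_hom).
- move=> a b ga gb; rewrite !fE //; last exact: sM.
  by rewrite rmorphM (hom_onM x_hom) //; apply: Cpi.
Qed.

(** If [rho b] has left factors in the image of the [j]-th component, then applying [h] shows that
    [tinl i b] has left factors in [generated (F j)], and [tens_retract] puts [b] there. *)
Lemma torsor_generated_union :
  exists F : I -> seq B, forall b, exists i, generated (F i) b.
Proof.
have [rho [delta [h [hl hr hrho]]]] := torsor_coaction P.
set w := gone G B in rho h hl hr hrho; set i := idfun in delta h hl hr hrho.
have /choice[F FP] : forall j, exists s, forall c,
    tens (generated s) (fun=> True) (delta (phi j c)).
  move=> j; have [s0 gen] := of_finite_type_gen (S_ft j).
  have [s [s' ss']] := tens_finite_hom (delta \o phi j) s0.
  exists s => c; apply: tensW (ss' c (gen c)) => //.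
exists F => b; have [j [s bj]] := tens_proj_image (rho b); exists j.
have Fsub := generated_subalgebra (F j).
apply: (@tens_retract _ _ _ i _ _ (subalgebra_subspace Fsub)).
rewrite -hrho; elim: bj => [|_ b' z [c ->] _ _ IH]; first by rewrite rmorph0; apply: tens0.
rewrite rmorphD rmorphM /= hl hr; apply: tens_add => //; apply: tens_mul => //.
  by case: Fsub.
rewrite -[tinr i b']mul1r -(rmorph1 (tinl i)).
by apply: tens1 => //; apply: subalgebra1.
Qed.

(* The Mittag-Leffler property of the system of partial points. *)
Lemma partial_point_extends s : exists t, {subset s <= t} /\
  forall p, partial_point t p -> forall s', exists v, partial_point s' v /\
    forall b, generated s b -> v b = p b.
Proof.
have [rho [delta [h [hl hr hrho]]]] := torsor_coaction P.
set w := gone G B in rho h hl hr hrho; set id_B := idfun in delta h hl hr hrho.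
have [[i0] _] := I_directed.
have [j [t1 [_ rho_s]]] := tens_proj_image_hom rho s i0.
have [s0 gen0] := of_finite_type_gen (S_ft j).
have [t2 [t2' delta_j]] := tens_finite_hom (delta \o phi j) s0.
(* [t] contains the factors occurring in [rho] on [generated s] and in [delta] on the [j]-th
   component, so that [delta(p, q)] is defined as a point of that component. *)
exists (s ++ t1 ++ t2 ++ t2'); split; first by move=> x xs; rewrite mem_cat xs.
set t := s ++ _ => p p_pt s'.
have t1t : {subset t1 <= t} by move=> x xt; rewrite !mem_cat xt !orbT.
have t2t : {subset t2 <= t} by move=> x xt; rewrite !mem_cat xt !orbT.
have t2't : {subset t2' <= t} by move=> x xt; rewrite !mem_cat xt !orbT.
have [j' [t3 [le_jj' rho_s']]] := tens_proj_image_hom rho s' j.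
(* [q] is multiplicative on [t3] as well, which makes the translate of [q] by a point of the
   component [j'] a partial point on [s']. *)
have [q q_pt] := partial_point_exists (t ++ t3).
have q_t : partial_point t q by apply: partial_point_sub q_pt => x xt; rewrite mem_cat xt.
have [p_lin p1 pM] := p_pt; have [q_lin q1 qM] := q_pt; have [_ _ qtM] := q_t.
have [L [L_lin LE]] := tensor_functional id_B p_lin q_lin.
have LM := tens_functional_mul pM qtM L_lin LE.
have L1 : L 1 = 1.
  by rewrite -[1]mulr1 -{1}(rmorph1 (tinl id_B)) -(rmorph1 (tinr id_B)) LE p1 q1 mulr1.
have delta_t c : tens (generated t) (generated t) (delta (phi j c)).
  by apply: tensW (delta_j c (gen0 c)) => b; apply: generated_sub.
have g_lin : is_linear (fun c => L (delta (phi j c))).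
  by move=> c a b; rewrite !linearP L_lin.
have g1 : L (delta (phi j 1)) = 1 by rewrite !rmorph1.
have gM : {morph (fun c => L (delta (phi j c))) : a b / a * b}.
  by move=> a b; rewrite /= (rmorphM (phi j)) (rmorphM delta) (LM _ _ (delta_t a) (delta_t b)).
pose g : points (group_coord (component S j)) k^o := mk_lrmorphism g_lin g1 gM.
have gE c : g c = L (delta (phi j c)) by [].
have g_ker : kills_kernel (phi j) g by move=> c c0; rewrite gE c0 rmorph0 (lin0 L_lin).
have [g' [g'_ker g'E]] := lift_point (G_limit.1 j j' le_jj') (S_ft j) (S_ft j') g_ker.
(* [y] extends [g'] from the image of the [j']-th component to a linear form on [k[G]], and [N] is
   the tensor product of [y] and [q]. *)
have [y [y_lin yE]] :=
  linear_factor (lrmorphism_linear (phi j')) (lrmorphism_linear g') g'_ker.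
have [N [N_lin NE]] := tensor_functional w y_lin q_lin.
exists (fun b => N (rho b)); split; first split.
- by move=> c a b; rewrite linearP N_lin.
- rewrite rmorph1 -[1]mulr1 -{1}(rmorph1 (tinl w)) -(rmorph1 (tinr w)) NE q1.
  by rewrite -(rmorph1 (phi j')) yE rmorph1 mulr1.
- move=> a b /rho_s' ra /rho_s' rb; rewrite rmorphM.
  apply: (tens_functional_mul _ _ N_lin NE ra rb) => [_ _ [c ->] [c' ->]|u v gu gv].
    by rewrite -rmorphM !yE rmorphM.
  by apply: qM; apply: generated_sub (_ : {subset t3 <= _}) _ => // x xt; rewrite mem_cat xt orbT.
(* On [generated s] only the restriction of [g'] to the component [j] matters; it is [delta(p, q)],
   so [g' q] agrees with [delta(p, q) q = p]. *)
move=> b /rho_s rb; transitivity (L (h (rho b))); last first.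
  by rewrite hrho -[tinl _ _]mulr1 -(rmorph1 (tinr id_B)) LE q1 mulr1.
apply: (@tens_ind_linear _ _ _ w _ N (fun z => L (h z)) (proj_image j) (generated t1)) rb => //.
  by move=> c u v; rewrite linearP L_lin.
move=> _ b' [c ->] gb'; rewrite NE rmorphM /= hl hr LM //; last first.
  rewrite -[tinr _ _]mul1r -(rmorph1 (tinl id_B)); apply: tens1.
    by apply: subalgebra1; apply: generated_subalgebra.
  exact: generated_sub gb'.
rewrite (G_limit.1 j j' le_jj') /= yE -[tinr _ _]mul1r -{1}(rmorph1 (tinl id_B)) LE p1 mul1r.
congr (_ * _); rewrite -[g' _]/(points_comap (comorph (transition S le_jj')) g' c) g'E gE.
by rewrite (G_limit.1 j j' le_jj').
Qed.

End TorsorPoints.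

(** * The two cardinality conditions *)

Section CountableCase.
Local Open Scope card_scope.
Variables (k : closedFieldType) (d : Order.disp_t) (I : porderType d).
Variables (S : inverse_system k I) (G : affine_group_scheme k).
Variable pr : forall i : I, group_scheme_hom G (component S i).
Hypothesis I_directed : directed_poset I.
Hypothesis S_ft : forall i : I, of_finite_type (component S i).
Hypothesis G_limit : is_inverse_limit pr.
Variable P : torsor G.
Local Notation B := (torsor_coord P).

(** Membership in the stable image. [v] itself may fail to be a partial point, but on [generated s]
    it agrees with one, as [s' = s] shows. *)
Definition extendable (s : seq B) (v : B -> k^o) :=
  forall s', exists w, partial_point s' w /\ forall b, generated s b -> w b = v b.

Lemma increasing_union_point (s : nat -> seq B) :
  (forall m n, (m <= n)%N -> {subset s m <= s n}) ->
  (forall b, exists n, generated (s n) b) -> inhabited (points B k^o).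
Proof.
move=> s_mono s_union.
have gen_mono m n b : (m <= n)%N -> generated (s m) b -> generated (s n) b.
  by move=> mn; apply: generated_sub; apply: s_mono.
have ML := partial_point_extends I_directed S_ft G_limit.
have [v0 v0P] : exists v, extendable (s 0%N) v.
  have [t [_ tP]] := ML P (s 0%N); have [v v_pt] := partial_point_exists t.
  by exists v => s'; apply: tP.
have /choice[step stepP] : forall nv : nat * (B -> k^o), exists v',
    extendable (s nv.1) nv.2 ->
    extendable (s nv.1.+1) v' /\ forall b, generated (s nv.1) b -> v' b = nv.2 b.
  move=> [n v] /=; have [vP|nv] := pselect (extendable (s n) v); last by exists v.
  (* Extending [v] to the sequence [t] attached to [s n.+1] gives a form that is again extendable
     from [s n.+1]: the maps between stable images are surjective. *)
  have [t [_ tP]] := ML P (s n.+1); have [w [w_pt wv]] := vP t.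
  by exists w => _; split=> // s'; apply: tP.
pose v := fix v n := if n is m.+1 then step (m, v m) else v0.
have vP n : extendable (s n) (v n).
  by elim: n => //= n IH; case: (stepP (n, v n) IH).
have vS n b : generated (s n) b -> v n.+1 b = v n b.
  by move=> gb; case: (stepP (n, v n) (vP n)) => _; apply.
have v_mono m n b : (m <= n)%N -> generated (s m) b -> v n b = v m b.
  move=> /subnKC <-; elim: (n - m)%N => [|j IH] gb; first by rewrite addn0.
  by rewrite addnS vS ?IH //; apply: gen_mono gb; apply: leq_addr.
have /choice[N NP] := s_union.
pose x b := v (N b) b.
have xE n b : generated (s n) b -> x b = v n b.
  move=> gb; case: (leqP (N b) n) => [|/ltnW] le; first by rewrite (v_mono _ _ _ le).
  by rewrite /x (v_mono _ _ _ le).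
have joint a b : exists n, generated (s n) a /\ generated (s n) b.
  exists (maxn (N a) (N b)); split.
    by apply: gen_mono (NP a); apply: leq_maxl.
  by apply: gen_mono (NP b); apply: leq_maxr.
have x_lin : is_linear x.
  move=> c a b; have [n [ga gb]] := joint a b.
  have [w [[w_lin _ _] wv]] := vP n (s n).
  have [_ sub] := subalgebra_subspace (generated_subalgebra (s n)).
  by rewrite !(xE n) -?wv //; apply: sub.
have x1 : x 1 = 1.
  have g1 := subalgebra1 (generated_subalgebra (s 0%N)).
  have [w [[_ w1 _] wv]] := vP 0%N (s 0%N).
  by rewrite (xE 0%N) // -wv.
have xM : {morph x : a b / a * b}.
  move=> a b; have [n [ga gb]] := joint a b.
  have [w [[_ _ wM] wv]] := vP n (s n).
  have [_ _ sub] := generated_subalgebra (s n).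
  have gab := sub _ _ ga gb.
  by rewrite !(xE n) // -!wv // wM.
by exists; exact: mk_lrmorphism x_lin x1 xM.
Qed.

Lemma countable_case : countable [set: I] -> inhabited (points B k^o).
Proof.
move=> /pcard_leTP[code]; have [F FP] := torsor_generated_union I_directed S_ft G_limit P.
have /choice[u uP] : forall n, exists s, forall i, code i = n -> s = F i.
  move=> n; have [[i in_]|no] := pselect (exists i, code i = n); last first.
    (* Numbers that code no index receive the empty sequence. *)
    by exists [::] => i in_; case: no; exists i.
  by exists (F i) => j jn; congr F; apply: (@inj _ _ setT code); rewrite ?inE // in_ jn.
apply: (@increasing_union_point (fun n => flatten (mkseq u n))).
  move=> m n mn b /flatten_mapP[j jm bj]; apply/flatten_mapP; exists j => //.
  by move: jm; rewrite !mem_iota !add0n => /leq_trans; apply.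
(* The successor is needed because [mkseq u n] stops at index [n - 1]. *)
move=> b; have [i gb] := FP b; exists (code i).+1.
apply: generated_sub gb => x xF; apply/flatten_mapP; exists (code i).
  by rewrite mem_iota add0n /=.
by rewrite (uP _ i erefl).
Qed.

End CountableCase.

(** * Fields larger than the index poset *)

Section LargeField.
Local Open Scope card_scope.
Variables (k : closedFieldType) (B : comAlgType k).

(* If t is not a scalar, then 1 / (t - c) is a rational function with a pole at
   c, and a finitely generated algebra over k[t] contains only finitely many. *)
Lemma finitely_many_poles (K : fieldType) (pi : {rmorphism B -> K}) (b : B) s :
  (forall c : k, pi b <> pi c%:A) ->
  exists p : {poly k}, p != 0 /\ forall c u, generated s u ->
    pi u * (pi b - pi c%:A) = 1 -> p.[c] = 0.
Proof.
move=> b_trans; pose iota : {rmorphism k -> K} := pi \o in_alg B.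
(* Polynomials over [k] split into linear factors, so a non-scalar element of [K] is transcendental
   over [k]. *)
have trans (p : {poly k}) : p != 0 -> (map_poly iota p).[pi b] != 0.
  move=> p0; have [r ->] := closed_field_poly_normal p.
  rewrite map_polyZ rmorph_prod hornerZ horner_prod mulf_neq0 //.
    by rewrite fmorph_eq0 lead_coef_eq0.
  rewrite prodf_seq_neq0; apply/allP => z _; rewrite rmorphB /= map_polyX map_polyC !hornerE subr_eq0.
  exact/eqP/b_trans.
have C0_sub := scalars_subalg iota.
pose C := adjoin1 (scalars iota) (pi b); pose C' := adjoin C (map pi s).
have C_sub : is_subalg iota C by apply: adjoin1_subalg.
have C'_sub : is_subalg iota C' by apply: adjoin_subalg.
have in_scalars h : poly_in (scalars iota) h -> exists p, h = map_poly iota p.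
  move=> hC; have /choice[q qP] := hC; exists (\poly_(i < size h) q i).
  apply/polyP => i; rewrite coef_map coef_poly; case: ltnP => hi; first exact: qP.
  by rewrite nth_default //; apply/esym/(rmorph0 iota).
have [a [[h [hC aE]] a0 aP]] := extend_adjoin C_sub (subalg1 C'_sub) (oner_neq0 K).
have [p pE] := in_scalars h hC; exists p; split.
  by apply: contra_neq a0 => p0; rewrite aE pE p0 rmorph0 horner0.
(* If [p] did not vanish at [c], evaluation at [c] would extend from [k[t]] to [C'], where [t - c]
   is invertible although it is sent to 0. *)
move=> c u gu uc; apply/eqP/contraT => pc.
have [x0 [x0_hom x0P]] := scalars_retraction iota.
have mapK q : map_poly x0 (map_poly iota q) = q.
  apply/polyP => i; rewrite coef_map_id0 ?coef_map ?x0P //.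
  by rewrite -(rmorph0 iota) x0P.
have [g gC gb|x [x_hom _ xE]] := hom_adjoin1 C0_sub x0_hom (t := pi b) (tau := c).
  have [q qE] := in_scalars g gC; rewrite qE mapK.
  have [->|/trans] := eqVneq q 0; first by rewrite horner0.
  by rewrite -qE gb eqxx.
have [|x' [x'_hom x'E _]] := aP x x_hom.
  by rewrite aE xE // pE mapK.
have Cb : C (pi b) by apply: (mem_adjoin1 C0_sub).
have C'b : C' (pi b) by apply: (sub_adjoin _ C_sub).
have C'c : C' (pi c%:A) by have [Ci _ _] := C'_sub; apply: (Ci c).
have C'u : C' (pi u).
  apply: (gu (fun u => C' (pi u))) => [|v vs].
    split=> [e|v v'|v v']; rewrite ?rmorphD ?rmorphM.
    - by have [Ce _ _] := C'_sub; apply: (Ce e).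
    - exact: (subalgD C'_sub).
    - exact: (subalgM C'_sub).
  by apply: (mem_adjoin C_sub); apply: map_f.
have xb : x' (pi b) = c.
  rewrite x'E // -[pi b](hornerX) xE.
    by rewrite -(map_polyX iota) mapK hornerX.
  by move=> i; rewrite coefX; case: (i == 1%N); [exists 1|exists 0]; rewrite (rmorph1, rmorph0).
have xc : x' (pi c%:A) = c by have [xi _ _] := x'_hom; apply: (xi c).
have := congr1 x' uc.
rewrite (hom_onM x'_hom) ?(hom_onB x'_hom) //; last exact: (subalgB C'_sub).
by rewrite xb xc subrr mulr0 (hom_on1 x'_hom) => /esym/eqP; rewrite oner_eq0.
Qed.

Lemma few_generated_point (J : Type) (F : J -> seq B) :
  (forall b, exists j, generated (F j) b) -> infinite_set [set: J] ->
  ~ ([set: k] #<= [set: J]) -> inhabited (points B k^o).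
Proof.
move=> Funion Jinf Jk.
have [||q [q_prime qS qmax]] := @max_ideal_avoiding B (fun a => a = 1).
- by split=> // a b -> ->; rewrite mulr1.
- by move/esym/eqP; rewrite oner_eq0.
have [K [pi piq]] := residue_field q_prime.
(* With [S] reduced to 1 the ideal [q] is maximal, so the image of [pi] is already a field. *)
have inv a : pi a <> 0 -> exists u, pi u * pi a = 1.
  move=> a0; have [|u [_ [-> /piq]]] := qmax a; first by move/piq.
  by rewrite rmorphB rmorphM rmorph1 => /eqP; rewrite subr_eq0 => /eqP E; exists u.
have [scal|] := pselect (forall b, exists c : k, pi b = pi c%:A).
  have /choice[x xP] := scal; pose iota : {rmorphism k -> K} := pi \o in_alg B.
  have xE b : iota (x b) = pi b by rewrite xP.
  have x_lin : @is_linear k B k^o x.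
    move=> c a b; apply: (fmorph_inj iota); rewrite xE rmorphD -mulr_algl rmorphM.
    by rewrite rmorphD rmorphM !xE.
  have x1 : x 1 = 1 by apply: (fmorph_inj iota); rewrite xE !rmorph1.
  have xM : {morph x : a b / a * b}.
    by move=> a b; apply: (fmorph_inj iota); rewrite xE !rmorphM !xE.
  by exists; exact: (@mk_lrmorphism k B k^o x x_lin x1 xM).
move=> /existsNP[b /forallNP b_trans]; exfalso; apply: Jk.
have /choice[u uP] : forall c : k, exists u, pi u * (pi b - pi c%:A) = 1.
  move=> c; have [|u] := inv (b - c%:A); last by rewrite rmorphB; exists u.
  by rewrite rmorphB => /eqP; rewrite subr_eq0 => /eqP; apply: b_trans.
have /choice[j jP] := fun c => Funion (u c).
have /choice[p pP] := fun i => finitely_many_poles (F i) b_trans.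
have root_p c : root (p (j c)) c.
  by have [_ pc] := pP (j c); apply/rootP/(pc c (u c)).
have /choice[r rP] : forall i, exists r : seq k, forall c, root (p i) c -> c \in r.
  move=> i; have [p0 _] := pP i; have [r pE] := closed_field_poly_normal (p i).
  by exists r => c; rewrite pE rootZ ?lead_coef_eq0 // root_prod_XsubC.
have [f f_inj] := infinite_prod_nat_injection Jinf.
(* Each [c] is recovered from [j c] and its position among the roots of [p (j c)]; the injection [f]
   absorbs the factor [nat]. *)
apply: (@injective_card_le _ _ (fun c => f (j c, index c (r (j c))))).
  move=> c c' /f_inj[jc]; rewrite -jc => E.
  have cr := rP _ _ (root_p c); have c'r := rP _ _ (root_p c'); rewrite -jc in c'r.
  by rewrite -(nth_index 0 cr) E nth_index.
Qed.
End LargeField.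

Theorem theorem1 (k : closedFieldType) (d : Order.disp_t) (I : porderType d)
    (S : inverse_system k I) (G : affine_group_scheme k)
    (pr : forall i : I, group_scheme_hom G (component S i)) :
  directed_poset I ->
  (forall i : I, of_finite_type (component S i)) ->
  is_inverse_limit pr ->
  countable [set: I] \/ card_lt I k ->
  forall P : torsor G, trivial_torsor P.
Proof.
move=> I_directed S_ft G_limit I_small P; rewrite /trivial_torsor.
(* The split is on countability and not on the two conditions, since under the second one [I] may be
   finite, while [few_generated_point] requires an infinite index type. *)
have [I_countable|I_uncountable] := pselect (countable [set: I]).
  exact: (countable_case I_directed S_ft G_limit).
case: I_small => // -[_ not_kI].
have [F FP] := torsor_generated_union I_directed S_ft G_limit P.
apply: few_generated_point FP _ not_kI => I_finite.
exact/I_uncountable/finite_set_countable.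
Qed.
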